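(* If $T(w,u,\ell)=0$ for all $w\in\mathbb Z$ and all $u,\ell\in\mathbb Z_{\ge0}$ with $u,\ell$ not both $0$, then the following relations hold in the $\imath$quantum group $\mathbf U^\imath_{\varsigma^\diamond,\mathbf 0}$: for all $i\neq j\in I$ with $\tau i=i$ and (any choice of) $\overline p_i\in\mathbb Z_2$, $$\sum_{n=0}^{1-a_{ij}}(-1)^nB_{i,\overline{a_{ij}}+\overline p_i}^{(n)}B_jB_{i,\overline p_i}^{(1-a_{ij}-n)}=0.$$
   Context: $q$-binomials. $q$ is an indeterminate, $[n]_q=\frac{q^n-q^{-n}}{q-q^{-1}}$, $[m]_q^!=[1]_q\cdots[m]_q$, $\begin{bmatrix}n\\d\end{bmatrix}_q=\frac{[n]_q\cdots[n-d+1]_q}{[d]_q^!}$ for $d\ge0$ and $0$ for $d<0$ ($n,d\in\mathbb Z$); subscripts $q^2$, $q_i$ mean replacing $q$ by $q^2$, $q_i$. The function $T$. For $w\in\mathbb Z$, $u,\ell\in\mathbb Z_{\ge0}$ not both $0$, $$\begin{aligned}T(w,u,\ell)=&\sum_{\substack{c,e,r\ge0\\c+e+r=u}}\ \sum_{\substack{t=0\\2\mid(t+w-r)}}^{\ell}q^{-t(\ell+u-1)+(\ell+u)(c-e)}\begin{bmatrix}\ell\\t\end{bmatrix}_q\begin{bmatrix}w+t-\ell\\ r\end{bmatrix}_q\begin{bmatrix}u-1+\frac{w+t-r}2\\c\end{bmatrix}_{q^2}\begin{bmatrix}\frac{w+t-r}2-\ell\\ e\end{bmatrix}_{q^2}\\&-\sum_{\substack{c,e,r\ge0\\c+e+r=u}}\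 \sum_{\substack{t=0\\2\nmid(t+w-r)}}^{\ell}q^{-t(\ell+u-1)+(\ell+u-1)(c-e)}\begin{bmatrix}\ell\\t\end{bmatrix}_q\begin{bmatrix}w+t-\ell\\ r\end{bmatrix}_q\begin{bmatrix}u+\frac{w+t-r-1}2\\c\end{bmatrix}_{q^2}\begin{bmatrix}\frac{w+t-r-1}2-\ell\\ e\end{bmatrix}_{q^2}.\end{aligned}$$ Root datum. $(I,\cdot)$ is a Cartan datum: $I$ is a finite set and $\cdot$ is a symmetric bilinear form on $\mathbb Z[I]$ with $i\cdot i\in\{2,4,6,\dots\}$ and $2\frac{i\cdot j}{i\cdot i}\in\{0,-1,-2,\dots\}$ for $i\ne j$. A root datum of type $(I,\cdot)$ is given: finitely generated free abelian groups $Y,X$ with a perfect bilinear pairing $\langle\cdot,\cdot\rangle:Y\times X\to\mathbb Z$, and embeddings $I\to X$, $i\mapsto\alpha_i$, $I\to Y$, $i\mapsto h_i$, with $a_{ij}:=\langle h_i,\alpha_j\rangle=2\frac{i\cdot j}{i\cdot i}$. The families $\{\alpha_i\}$ and $\{h_i\}$ are assumed linearly independent. Put $\epsilon_i=\frac{i\cdot i}{2}$, $q_i=q^{\epsilon_i}$; $\mathbb K$ is a field of characteristic $0$. Quantum group. $\mathbf U$ is the associative $\mathbb K(q)$-algebra with generators $E_i,F_i$ ($i\in I$), $K_h$ ($h\in Y$) and relations $K_0=1$, $K_hK_{h'}=K_{h+h'}$, $K_hE_i=q^{\langle h,\alpha_i\rangle}E_iK_h$, $K_hF_i=q^{-\langle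 h,\alpha_i\rangle}F_iK_h$, $[E_i,F_j]=\delta_{ij}\frac{\widetilde K_i-\widetilde K_i^{-1}}{q_i-q_i^{-1}}$ with $\widetilde K_i=K_{h_i}^{\epsilon_i}$, and $S_{ij}(E_i,E_j)=0=S_{ij}(F_i,F_j)$ for $i\ne j$, where $S_{ij}(x,y)=\sum_{n=0}^{1-a_{ij}}(-1)^n\begin{bmatrix}1-a_{ij}\\ n\end{bmatrix}_{q_i}x^nyx^{1-a_{ij}-n}$. The algebra $\mathbf U^\imath_{\varsigma^\diamond,\mathbf 0}$. $\tau$ is a permutation of $I$ with $\tau^2=\mathrm{id}$ ($\tau=\mathrm{id}$ allowed) and $\tau i\cdot\tau j=i\cdot j$, which is assumed to extend to involutions (also denoted $\tau$) of $X$ and of $Y$ (with $\tau(\alpha_i)=\alpha_{\tau i}$, $\tau(h_i)=h_{\tau i}$) preserving the pairing. $Y^\imath=\{h\in Y\mid\tau(h)=-h\}$. The distinguished parameters $\varsigma^\diamond=(\varsigma^\diamond_i)_{i\in I}\in(\mathbb K(q)^\times)^I$ satisfy $\varsigma^\diamond_i=q_i^{-1}$ if $\tau i=i$, and are otherwise arbitrary subject to $\varsigma^\diamond_i=\varsigma^\diamond_{\tau i}$ if $a_{i,\tau i}=0$. $\mathbf U^\imath_{\varsigma^\diamond,\mathbf 0}$ is the $\mathbb K(q)$-subalgebra of $\mathbf U$ generated by $B_i=F_i+\varsigma^\diamond_iE_{\tau i}\widetilde K_i^{-1}$ ($i\in I$) and $K_\mu$ ($\mu\in Y^\imath$). $\imath$Divided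 powers (for $\tau i=i$, with parameter $\varsigma^\diamond_i=q_i^{-1}$), for $\overline p\in\mathbb Z_2=\{\bar0,\bar1\}$: $B_{i,\bar1}^{(m)}=\frac1{[m]_{q_i}^!}B_i\prod_{j=1}^k(B_i^2-[2j-1]_{q_i}^2)$ if $m=2k+1$, and $\frac1{[m]_{q_i}^!}\prod_{j=1}^k(B_i^2-[2j-1]_{q_i}^2)$ if $m=2k$; $B_{i,\bar0}^{(m)}=\frac1{[m]_{q_i}^!}B_i\prod_{j=1}^k(B_i^2-[2j]_{q_i}^2)$ if $m=2k+1$, and $\frac1{[m]_{q_i}^!}\prod_{j=1}^k(B_i^2-[2j-2]_{q_i}^2)$ if $m=2k$. For $k\in\mathbb Z$, $\overline k$ denotes its class in $\mathbb Z_2$. *)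

(* Defs.v *)
From HB Require Import structures.
From mathcomp Require Import all_boot all_order all_algebra.
From mathcomp Require Import boolp.
From mathcomp.multinomials Require Import monalg.

Set Implicit Arguments.
Unset Strict Implicit.
Unset Printing Implicit Defensive.

Import Order.TTheory GRing.Theory Num.Theory.

Local Open Scope ring_scope.
Local Open Scope quotient_scope.

HB.mixin Record isRightMulClosed (A : nzRingType) (J : A -> bool) := {
  rightMul_subproof : forall a, {in (J : {pred A}), forall u, u * a \in (J : {pred A})}
}.

(* [idealr] is stable by left multiplications (and does not contain 1). *)
#[short(type="ideal2")]
HB.structure Definition Ideal2 (A : nzRingType) :=
  {J of Idealr A J & isRightMulClosed A J}.

Section IdealQuotient.
Variables (R : comNzRingType) (A : algType R) (J : ideal2 A).

Definition quotAlg : Type := Quotient.quot J.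

HB.instance Definition _ := GRing.Zmodule.on quotAlg.
HB.instance Definition _ := EqQuotient.on quotAlg.

Definition quot_pi (x : A) : quotAlg := \pi_(Quotient.quot J) x.

Lemma quot_piP (x y : A) : reflect (quot_pi x = quot_pi y) (x - y \in J).
Proof. by rewrite Quotient.idealrBE; exact: eqP. Qed.

Lemma quot_piK (x : quotAlg) : quot_pi (repr x) = x.
Proof. exact: reprK. Qed.

Lemma quot_pi0 : quot_pi 0 = 0.
Proof. by rewrite /quot_pi (raddf0 (\pi_(Quotient.quot J))). Qed.

Lemma quot_piD : {morph quot_pi : x y / x + y}.
Proof. by move=> x y; rewrite /quot_pi (raddfD (\pi_(Quotient.quot J))). Qed.

Definition quot_one : quotAlg := quot_pi 1.
Definition quot_mul (x y : quotAlg) : quotAlg := quot_pi (repr x * repr y).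
Definition quot_scale (c : R) (x : quotAlg) : quotAlg := quot_pi (c *: repr x).

Lemma quot_piM x y : quot_pi (x * y) = quot_mul (quot_pi x) (quot_pi y).
Proof.
apply/quot_piP; rewrite -[x * y](addrNK (x * repr (quot_pi y))) -mulrBr.
rewrite -addrA -mulrBl rpredD //.
  by apply: idealMr; apply/quot_piP; rewrite quot_piK.
by apply: rightMul_subproof; apply/quot_piP; rewrite quot_piK.
Qed.

Lemma quot_piZ c x : quot_pi (c *: x) = quot_scale c (quot_pi x).
Proof.
apply/quot_piP; rewrite -scalerBr -[x - _]mul1r scalerAl.
by apply: idealMr; apply/quot_piP; rewrite quot_piK.
Qed.

Lemma quot_mulA : associative quot_mul.
Proof.
move=> x y z; rewrite -[x]quot_piK -[y]quot_piK -[z]quot_piK.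
by rewrite -!quot_piM mulrA.
Qed.

Lemma quot_mul1q : left_id quot_one quot_mul.
Proof. by move=> x; rewrite -[x]quot_piK -quot_piM mul1r. Qed.

Lemma quot_mulq1 : right_id quot_one quot_mul.
Proof. by move=> x; rewrite -[x]quot_piK -quot_piM mulr1. Qed.

Lemma quot_mulDl : left_distributive quot_mul +%R.
Proof.
move=> x y z; rewrite -[x]quot_piK -[y]quot_piK -[z]quot_piK.
by rewrite -quot_piD -!quot_piM -quot_piD mulrDl.
Qed.

Lemma quot_mulDr : right_distributive quot_mul +%R.
Proof.
move=> x y z; rewrite -[x]quot_piK -[y]quot_piK -[z]quot_piK.
by rewrite -quot_piD -!quot_piM -quot_piD mulrDr.
Qed.

Lemma quot_one_neq0 : quot_one != 0.
Proof.
by apply/negP => /eqP; rewrite -quot_pi0 => /quot_piP; rewrite subr0 idealr1.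
Qed.

HB.instance Definition _ := GRing.Zmodule_isNzRing.Build quotAlg
  quot_mulA quot_mul1q quot_mulq1 quot_mulDl quot_mulDr quot_one_neq0.

Lemma quot_scaleA a b x :
  quot_scale a (quot_scale b x) = quot_scale (a * b) x.
Proof. by rewrite -[x]quot_piK -!quot_piZ scalerA. Qed.

Lemma quot_scale1 : left_id 1 quot_scale.
Proof. by move=> x; rewrite -[x]quot_piK -quot_piZ scale1r. Qed.

Lemma quot_scaleDr : right_distributive quot_scale +%R.
Proof.
move=> a x y; rewrite -[x]quot_piK -[y]quot_piK.
by rewrite -quot_piD -!quot_piZ -quot_piD scalerDr.
Qed.

Lemma quot_scaleDl x : {morph quot_scale^~ x : a b / a + b}.
Proof.
by move=> a b; rewrite -[x]quot_piK -!quot_piZ -quot_piD scalerDl.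
Qed.

HB.instance Definition _ := GRing.Zmodule_isLmodule.Build R quotAlg
  quot_scaleA quot_scale1 quot_scaleDr quot_scaleDl.

Lemma quot_scaleAl (a : R) (x y : quotAlg) : a *: (x * y) = (a *: x) * y.
Proof.
rewrite -[x]quot_piK -[y]quot_piK.
have E u v : quot_pi u * quot_pi v = quot_pi (u * v) by rewrite quot_piM.
have Z u : a *: quot_pi u = quot_pi (a *: u) by rewrite quot_piZ.
by rewrite E !Z E scalerAl.
Qed.

HB.instance Definition _ := GRing.Lmodule_isLalgebra.Build R quotAlg
  quot_scaleAl.

Lemma quot_scaleAr (a : R) (x y : quotAlg) : a *: (x * y) = x * (a *: y).
Proof.
rewrite -[x]quot_piK -[y]quot_piK.
have E u v : quot_pi u * quot_pi v = quot_pi (u * v) by rewrite quot_piM.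
have Z u : a *: quot_pi u = quot_pi (a *: u) by rewrite quot_piZ.
by rewrite E !Z E scalerAr.
Qed.

HB.instance Definition _ := GRing.Lalgebra_isAlgebra.Build R quotAlg
  quot_scaleAr.

Lemma quot_pi_is_zmod_morphism : zmod_morphism quot_pi.
Proof. by move=> x y; rewrite /quot_pi (raddfB (\pi_(Quotient.quot J))). Qed.

HB.instance Definition _ := GRing.isZmodMorphism.Build A quotAlg quot_pi
  quot_pi_is_zmod_morphism.
HB.instance Definition _ := GRing.isMonoidMorphism.Build A quotAlg quot_pi
  (erefl, quot_piM).
HB.instance Definition _ := GRing.isScalable.Build R A quotAlg *:%R quot_pi
  quot_piZ.

End IdealQuotient.


Section Generated.
Variables (R : comNzRingType) (A : algType R).

Definition is_ideal2 (J : {pred A}) : Prop :=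
  [/\ 0 \in J, {in J &, forall x y, x - y \in J},
      forall a, {in J, forall x, a * x \in J} &
      forall a, {in J, forall x, x * a \in J}].

Definition ideal_gen (S : A -> Prop) : {pred A} := fun x =>
  `[< forall J : {pred A}, is_ideal2 J -> (forall s, S s -> s \in J) -> x \in J >].

Definition subalg_gen (S : A -> Prop) : {pred A} := fun x =>
  `[< forall B : {pred A}, GRing.subalg_closed B ->
        (forall s, S s -> s \in B) -> x \in B >].

Lemma ideal_gen_is_ideal2 S : is_ideal2 (ideal_gen S).
Proof.
split.
- by apply/asboolP => J [].
- move=> x y /asboolP hx /asboolP hy; apply/asboolP => J hJ SJ.
  by have [_ hB _ _] := hJ; apply: hB; [exact: hx | exact: hy].
- move=> a x /asboolP hx; apply/asboolP => J hJ SJ.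
  by have [_ _ hM _] := hJ; apply: hM; exact: hx.
- move=> a x /asboolP hx; apply/asboolP => J hJ SJ.
  by have [_ _ _ hM] := hJ; apply: hM; exact: hx.
Qed.

Lemma ideal_gen_sub (S : A -> Prop) x : S x -> x \in ideal_gen S.
Proof. by move=> Sx; apply/asboolP => J _; apply. Qed.

Lemma subalg_gen_closed S : GRing.subalg_closed (subalg_gen S).
Proof.
split.
- by apply/asboolP => B [].
- move=> a x y /asboolP hx /asboolP hy; apply/asboolP => B hB SB.
  by have [_ hL _] := hB; apply: hL; [exact: hx | exact: hy].
- move=> x y /asboolP hx /asboolP hy; apply/asboolP => B hB SB.
  by have [_ _ hM] := hB; apply: hM; [exact: hx | exact: hy].
Qed.

Lemma subalg_gen_sub (S : A -> Prop) x : S x -> x \in subalg_gen S.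
Proof. by move=> Sx; apply/asboolP => B _; apply. Qed.

HB.instance Definition _ (S : A -> Prop) :=
  GRing.isSubalgClosed.Build R A (subalg_gen S) (subalg_gen_closed S).

Record subalgType (S : A -> Prop) := SubalgType {
  subalg_val : A;
  subalg_valP : subalg_val \in subalg_gen S
}.

HB.instance Definition _ S := [isSub for @subalg_val S].
HB.instance Definition _ S := [Choice of subalgType S by <:].
HB.instance Definition _ S := [SubChoice_isSubAlgebra of subalgType S by <:].

Definition subalg_in (S : A -> Prop) (x : A) (Sx : S x) : subalgType S :=
  SubalgType (subalg_gen_sub Sx).

End Generated.

Section FreeAlgebra.
Variables (R : comNzRingType) (G : choiceType).

Definition freeAlg : Type := {malg R[{fmonom G}]}.

HB.instance Definition _ := GRing.Lalgebra.on freeAlg.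

Lemma freeAlg_scaleAr (c : R) (x y : freeAlg) : c *: (x * y) = x * (c *: y).
Proof.
have cC (z : {malg R[{fmonom G}]}) : c%:MP * z = z * c%:MP.
  rewrite malgM_def fgmulUg malgM_def fgmulgU.
  by apply: eq_bigr => k _; rewrite mul1m mulm1 mulrC.
change ((c *: ((x : {malg R[{fmonom G}]}) * y))
        = (x : {malg R[{fmonom G}]}) * (c *: (y : {malg R[{fmonom G}]}))).
by rewrite -!mul_malgC !mulrA cC.
Qed.

HB.instance Definition _ := GRing.Lalgebra_isAlgebra.Build R freeAlg
  freeAlg_scaleAr.

Definition freeGen (g : G) : freeAlg := << fmu g >>.

(* Algebra morphism to the base ring with prescribed values on generators;
   only used to see that ideals given by relations are proper. *)
Variable e : G -> R.

Definition fmonom_eval (m : {fmonom G}) : R := \prod_(g <- (m : seq G)) e g.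

Lemma fmonom_eval_mmorphism : mmorphism fmonom_eval.
Proof.
split=> [x y|]; rewrite /fmonom_eval; first by rewrite fmM big_cat.
by rewrite fm1 big_nil.
Qed.

HB.instance Definition _ := monalg.isMultiplicative.Build {fmonom G} R
  fmonom_eval fmonom_eval_mmorphism.

Definition free_eval (x : freeAlg) : R := mmap idfun fmonom_eval x.

Lemma free_eval_is_zmod_morphism : zmod_morphism free_eval.
Proof. exact: (raddfB (mmap (idfun : R -> R) fmonom_eval)). Qed.

Lemma free_eval_is_monoid_morphism : monoid_morphism free_eval.
Proof.
split; first exact: (rmorph1 (mmap (idfun : R -> R) fmonom_eval)).
exact: (rmorphM (mmap (idfun : R -> R) fmonom_eval)).
Qed.

HB.instance Definition _ := GRing.isZmodMorphism.Build freeAlg R free_eval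
  free_eval_is_zmod_morphism.
HB.instance Definition _ := GRing.isMonoidMorphism.Build freeAlg R free_eval
  free_eval_is_monoid_morphism.

Lemma free_evalZ c x : free_eval (c *: x) = c * free_eval x.
Proof. exact: mmapZ. Qed.

Lemma free_evalU g : free_eval (freeGen g) = e g.
Proof.
by rewrite /free_eval mmapU mul1r /fmonom_eval fmU big_cons big_nil mulr1.
Qed.

End FreeAlgebra.

Section QNumbers.
Variables (F : fieldType) (v : F).

Definition qint (n : int) : F := (v ^ n - v ^ (- n)) / (v - v^-1).

Definition qfact (m : nat) : F := \prod_(1 <= k < m.+1) qint k%:Z.

Definition qbinom (n d : int) : F :=
  match d with
  | Posz k => (\prod_(i < k) qint (n - i%:Z)) / qfact k
  | Negz _ => 0
  end.

End QNumbers.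

Section Tfun.
Variables (F : fieldType) (q : F).

Definition Tfun (w : int) (u l : nat) : F :=
  (\sum_(c < u.+1) \sum_(e < u.+1) \sum_(r < u.+1 | (c + e + r == u)%N)
   \sum_(t < l.+1 | (2 %| t%:Z + w - r%:Z)%Z)
     q ^ (- t%:Z * (l%:Z + u%:Z - 1) + (l%:Z + u%:Z) * (c%:Z - e%:Z))
     * qbinom q l%:Z t%:Z
     * qbinom q (w + t%:Z - l%:Z) r%:Z
     * qbinom (q ^+ 2) (u%:Z - 1 + ((w + t%:Z - r%:Z) %/ 2)%Z) c%:Z
     * qbinom (q ^+ 2) (((w + t%:Z - r%:Z) %/ 2)%Z - l%:Z) e%:Z)
  - (\sum_(c < u.+1) \sum_(e < u.+1) \sum_(r < u.+1 | (c + e + r == u)%N)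
     \sum_(t < l.+1 | ~~ (2 %| t%:Z + w - r%:Z)%Z)
     q ^ (- t%:Z * (l%:Z + u%:Z - 1) + (l%:Z + u%:Z - 1) * (c%:Z - e%:Z))
     * qbinom q l%:Z t%:Z
     * qbinom q (w + t%:Z - l%:Z) r%:Z
     * qbinom (q ^+ 2) (u%:Z + ((w + t%:Z - r%:Z - 1) %/ 2)%Z) c%:Z
     * qbinom (q ^+ 2) (((w + t%:Z - r%:Z - 1) %/ 2)%Z - l%:Z) e%:Z).

End Tfun.

(* The bilinear form on Z[I], given by its values on the basis I. *)
Record cartanDatum (I : finType) := CartanDatum {
  cdot :> I -> I -> int;
  cdotC : forall i j, cdot i j = cdot j i;
  cdot_diag : forall i, (0 < cdot i i) && (2 %| cdot i i)%Z;
  cdot_offdiag : forall i j, i != j ->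
    exists n : nat, 2 * cdot i j = - n%:Z * cdot i i
}.

Definition fg_free (V : zmodType) : Prop :=
  exists n (f : {additive 'rV[int]_n -> V}), bijective f.

Definition Z_lin_indep (I : finType) (V : zmodType) (x : I -> V) : Prop :=
  forall c : I -> int, \sum_i x i *~ c i = 0 -> forall i, c i = 0.

Record rootDatum (I : finType) (C : cartanDatum I) := RootDatum {
  rd_Y : zmodType;
  rd_X : zmodType;
  rd_Y_free : fg_free rd_Y;
  rd_X_free : fg_free rd_X;
  rd_pair : rd_Y -> rd_X -> int;
  rd_pairDl : forall x, {morph rd_pair^~ x : h h' / h + h'};
  rd_pairDr : forall h, {morph rd_pair h : x x' / x + x'};
  rd_perfectX : forall f : {additive rd_X -> int},
    exists! h, forall x, rd_pair h x = f x;
  rd_perfectY : forall f : {additive rd_Y -> int},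
    exists! x, forall h, rd_pair h x = f h;
  rd_alpha : I -> rd_X;
  rd_h : I -> rd_Y;
  rd_alpha_inj : injective rd_alpha;
  rd_h_inj : injective rd_h;
  rd_alpha_indep : Z_lin_indep rd_alpha;
  rd_h_indep : Z_lin_indep rd_h;
  (* a_ij = 2 (i . j) / (i . i), where i . i > 0 *)
  rd_cartan : forall i j,
    rd_pair (rd_h i) (rd_alpha j) * C i i = 2 * C i j
}.

Definition cartan I (C : cartanDatum I) (D : rootDatum C) (i j : I) : int :=
  rd_pair (rd_h D i) (rd_alpha D j).

Definition eps I (C : cartanDatum I) (i : I) : nat := `|C i i|%N./2.

Record diagramInvolution I (C : cartanDatum I) (D : rootDatum C) :=
  DiagramInvolution {
  tau :> I -> I;
  tauX : {additive rd_X D -> rd_X D};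
  tauY : {additive rd_Y D -> rd_Y D};
  tauK : involutive tau;
  tau_dot : forall i j, C (tau i) (tau j) = C i j;
  tauXK : involutive tauX;
  tauYK : involutive tauY;
  tauX_alpha : forall i, tauX (rd_alpha D i) = rd_alpha D (tau i);
  tauY_h : forall i, tauY (rd_h D i) = rd_h D (tau i);
  tau_pair : forall h x, rd_pair (tauY h) (tauX x) = rd_pair h x
}.

Definition serre (F : fieldType) (A : algType F) (v : F) (m : nat) (x y : A) : A :=
  \sum_(n < m.+1) ((-1) ^+ n * qbinom v m%:Z n%:Z) *: (x ^+ n * y * x ^+ (m - n)).

(* 1 - a_ij, for i != j *)
Definition serre_deg I (C : cartanDatum I) (D : rootDatum C) (i j : I) : nat :=
  `|1 - cartan D i j|%N.

Section Relations.
Variables (F : fieldType) (q : F).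
Variables (I : finType) (C : cartanDatum I) (D : rootDatum C).

Definition qi (i : I) : F := q ^+ eps C i.

Variables (A : algType F) (E G : I -> A) (K : rd_Y D -> A).

(* K_{-h} is the inverse of K_h by the first two relations below. *)
Definition Ktilde (i : I) : A := K (rd_h D i) ^+ eps C i.
Definition KtildeV (i : I) : A := K (- rd_h D i) ^+ eps C i.

(* Left minus right hand sides of the relations between the generators
   E_i, F_i (here G i) and K_h. *)
Inductive Urel : A -> Prop :=
| Urel_K0 : Urel (K 0 - 1)
| Urel_KK h h' : Urel (K h * K h' - K (h + h'))
| Urel_KE h i :
    Urel (K h * E i - q ^ rd_pair h (rd_alpha D i) *: (E i * K h))
| Urel_KF h i :
    Urel (K h * G i - q ^ (- rd_pair h (rd_alpha D i)) *: (G i * K h))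
| Urel_EF i j :
    Urel (E i * G j - G j * E i
          - ((i == j)%:R / (qi i - (qi i)^-1)) *: (Ktilde i - KtildeV i))
| Urel_serreE i j of i != j : Urel (serre (qi i) (serre_deg D i j) (E i) (E j))
| Urel_serreF i j of i != j : Urel (serre (qi i) (serre_deg D i j) (G i) (G j)).

Lemma Urel_counit (ev : A -> F) :
    (forall i, ev (E i) = 0) -> (forall i, ev (G i) = 0) ->
    (forall h, ev (K h) = 1) -> zmod_morphism ev -> monoid_morphism ev ->
    (forall c a, ev (c *: a) = c * ev a) ->
  forall x, Urel x -> ev x = 0.
Proof.
move=> eE eG eK eB [e1 eM] eZ.
have e0 : ev 0 = 0 by rewrite -(subrr (0 : A)) eB subrr.
have eN a : ev (- a) = - ev a by rewrite -[- a]sub0r eB e0 sub0r.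
have eD a b : ev (a + b) = ev a + ev b by rewrite -[b]opprK eB [in LHS]eN !opprK.
have eX a n : ev (a ^+ n) = ev a ^+ n.
  by elim: n => [|n IHn]; rewrite ?expr0 // !exprS eM IHn.
have serre0 (y z : A) v m : ev z = 0 -> ev (serre v m y z) = 0.
  move=> z0; rewrite /serre (big_morph ev eD e0) big1 // => n _.
  by rewrite eZ !eM z0 mulr0 mul0r mulr0.
move=> _ [|h h'|h i|h i|i j|i j _|i j _].
- by rewrite eB eK e1 subrr.
- by rewrite eB eM !eK mulr1 subrr.
- by rewrite eB eZ !eM eE mulr0 mul0r mulr0 subrr.
- by rewrite eB eZ !eM eG mulr0 mul0r mulr0 subrr.
- rewrite !eB eZ !eM eB !eX eE eG !eK.
  by rewrite !expr1n mul0r !subrr mulr0 subrr.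
- by rewrite serre0.
- by rewrite serre0.
Qed.

End Relations.

Section QuantumGroup.
Variables (F : fieldType) (q : F).
Variables (I : finType) (C : cartanDatum I) (D : rootDatum C).

Definition Ugen : choiceType := (I + I + rd_Y D)%type.
Definition Ufree : algType F := freeAlg F Ugen.

Definition fE (i : I) : Ufree := freeGen F (inl (inl i) : Ugen).
Definition fF (i : I) : Ufree := freeGen F (inl (inr i) : Ugen).
Definition fK (h : rd_Y D) : Ufree := freeGen F (inr h : Ugen).

Definition Uideal : {pred Ufree} := ideal_gen (Urel q fE fF fK).

(* mathcomp algebras are nontrivial, hence Uideal must be shown to be proper:
   the counit kills the relations. *)
Definition counit_gen (g : Ugen) : F := if g is inr _ then 1 else 0.

Lemma Uideal_counit x : x \in Uideal -> free_eval counit_gen x = 0.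
Proof.
pose ev : Ufree -> F := free_eval counit_gen; rewrite -/(ev x).
have eB : zmod_morphism ev by exact: free_eval_is_zmod_morphism.
have eM : monoid_morphism ev by exact: free_eval_is_monoid_morphism.
have eR : forall y, Urel q fE fF fK y -> ev y = 0.
  apply: Urel_counit => //; try by move=> *; exact: free_evalU.
  exact: free_evalZ.
pose J : {pred Ufree} := fun x => ev x == 0.
move=> /asboolP /(_ J) hJ; apply/eqP; apply: hJ; last first.
  by move=> y /eR/eqP.
split.
- by apply/eqP; rewrite -(subrr (1 : Ufree)) eB subrr.
- by move=> a b /eqP ha /eqP hb; apply/eqP; rewrite eB ha hb subrr.
- by move=> a b /eqP hb; apply/eqP; rewrite eM.2 hb mulr0.
- by move=> a b /eqP hb; apply/eqP; rewrite eM.2 hb mul0r.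
Qed.

Lemma Uideal_zmod_closed : zmod_closed Uideal.
Proof. by have [h0 hB _ _] := ideal_gen_is_ideal2 (Urel q fE fF fK); split. Qed.

Lemma Uideal_proper :
  1 \notin Uideal /\ forall a, {in Uideal, forall u, a * u \in Uideal}.
Proof.
split; last by have [_ _ hM _] := ideal_gen_is_ideal2 (Urel q fE fF fK).
by apply/negP => /Uideal_counit/eqP; rewrite rmorph1 oner_eq0.
Qed.

Lemma Uideal_right : forall a, {in Uideal, forall u, u * a \in Uideal}.
Proof. by have [_ _ _ hM] := ideal_gen_is_ideal2 (Urel q fE fF fK). Qed.

HB.instance Definition _ :=
  GRing.isZmodClosed.Build Ufree Uideal Uideal_zmod_closed.
HB.instance Definition _ := isProperIdeal.Build Ufree Uideal Uideal_proper.
HB.instance Definition _ := isRightMulClosed.Build Ufree Uideal Uideal_right.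

Definition Uq : algType F := quotAlg (Uideal : ideal2 Ufree).

Definition UqPi (x : Ufree) : Uq := quot_pi (Uideal : ideal2 Ufree) x.

Definition UE (i : I) : Uq := UqPi (fE i).
Definition UF (i : I) : Uq := UqPi (fF i).
Definition UK (h : rd_Y D) : Uq := UqPi (fK h).

End QuantumGroup.

Section IQuantumGroup.
Variables (F : fieldType) (q : F).
Variables (I : finType) (C : cartanDatum I) (D : rootDatum C).
Variables (t : diagramInvolution D) (vs : I -> F).

Definition distinguished : Prop :=
  [/\ forall i, vs i != 0,
      forall i, t i = i -> vs i = (qi q C i)^-1 &
      forall i, cartan D i (t i) = 0 -> vs i = vs (t i)].

Definition UB (i : I) : Uq q D := UF q D i + vs i *: (UE q D (t i) * KtildeV (@UK _ q _ _ D) i).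

Inductive Ui_gen : Uq q D -> Prop :=
| Ui_genB i : Ui_gen (UB i)
| Ui_genK h of tauY t h = - h : Ui_gen (UK q h).

Definition Ui : algType F := subalgType Ui_gen.

Definition iB (i : I) : Ui := subalg_in (Ui_genB i).

End IQuantumGroup.

Definition idivpow (F : fieldType) (A : algType F) (v : F) (b : A)
    (p : 'Z_2) (m : nat) : A :=
  let z (j : nat) : int :=
    if p == 1 then 2 * j%:Z - 1
    else if odd m then 2 * j%:Z else 2 * j%:Z - 2 in
  (qfact v m)^-1 *:
    ((if odd m then b else 1)
     * \prod_(1 <= j < m./2.+1) (b ^+ 2 - (qint v (z j) ^+ 2)%:A)).

Definition qvar (K : fieldType) : {fraction {poly K}} := tofrac 'X.

(* Main.v *)
(** Write [b = B_i], [m = - a_ij], [N = m + 1] and [v = q_i], and let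
    [S_N(x) = sum_n (-1)^n b_{m+p}^{(n)} x b_p^{(N-n)}].  The recursion of the
    idivided powers gives, with no assumption on [x],
      [N+2][N+1] S_{N+2}(x) = S_N(Q_{N+1} x),
      Q_k x = b^2 x - (v^k + v^-k) b x b + x b^2 - [k]^2 x,
    so [S_N] is, up to a scalar, a product of quadratic factors [Q_k] (and of
    [x |-> x b - b x] if [N] is odd).

    For [x = F_j], the [q]-commutators [X_0 = x],
    [X_{k+1} = F_i X_k - v^(2k-m) X_k F_i] end with [X_{m+1} = 0] by the Serre
    relation and satisfy a three-term relation
      [b X_k = v^(2k-m) X_k b + X_{k+1} + v^(2k-m-1) [k][m+1-k] X_{k-1}].
    Applying [Q_m] to [X_0] produces the initial term of a sequence of the same
    kind for [m - 2], whence [S_N(X_0) = 0] by induction.  The summand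
    [E_{tau j} K_j^-1] of [B_j] is treated by the symmetry exchanging [F_i] and
    [v^-1 E_i K_i^-1] and inverting [v]. *)

Require Import Defs.
From HB Require Import structures.
From mathcomp Require Import all_boot all_order all_algebra.
From mathcomp Require Import ring zify.

Set Implicit Arguments.
Unset Strict Implicit.
Unset Printing Implicit Defensive.

Import Order.TTheory GRing.Theory Num.Theory.
Local Open Scope ring_scope.

(** * Quantum integers at a generic parameter *)

Section QIntegers.
Variables (F : fieldType) (v : F).

Lemma qint0 : qint v 0 = 0.
Proof. by rewrite /qint oppr0 subrr mul0r. Qed.

Lemma qint_inv n : qint v^-1 n = qint v n.
Proof. by rewrite /qint !exprz_inv opprK invrK -opprB -[v^-1 - v]opprB invrN mulrNN. Qed.

Lemma qfact_inv n : qfact v^-1 n = qfact v n.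
Proof. by apply: eq_bigr => k _; rewrite qint_inv. Qed.

Lemma qfactS n : qfact v n.+1 = qfact v n * qint v n.+1%:Z.
Proof. by rewrite /qfact big_nat_recr. Qed.

Lemma idivpow_inv (A : algType F) (b : A) p n :
  idivpow v^-1 b p n = idivpow v b p n.
Proof.
rewrite /idivpow qfact_inv; congr (_ *: (_ * _)).
by apply: eq_bigr => j _; rewrite qint_inv.
Qed.

Definition q_generic := v != 0 /\ forall n : nat, qint v n.+1%:Z != 0.
Hypothesis gen : q_generic.

Lemma generic_neq0 : v != 0. Proof. by case: gen. Qed.

(** Division by zero yields zero, so [v = v^-1] would make [[1]] vanish. *)
Lemma generic_subV_neq0 : v - v^-1 != 0.
Proof.
by case: gen => _ /(_ 0%N); apply: contraNneq => d0; rewrite /qint d0 invr0 mulr0.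
Qed.

Lemma generic_sqr_neq1 : v * v - 1 != 0.
Proof.
apply: contraNneq generic_subV_neq0 => d0.
have -> : v - v^-1 = (v * v - 1) / v by field; exact: generic_neq0.
by rewrite d0 mul0r.
Qed.

Lemma qfact_neq0 n : qfact v n != 0.
Proof.
by elim: n => [|n IHn]; [rewrite /qfact big_geq ?oner_neq0 | rewrite qfactS mulf_neq0 // gen.2].
Qed.

End QIntegers.

Lemma q_generic_inv (F : fieldType) (v : F) : q_generic v -> q_generic v^-1.
Proof. by case=> v0 h; split=> [|n]; rewrite ?invr_eq0 ?qint_inv. Qed.

(* [field] after turning every [v ^ n] into a monomial in atoms [v ^ a], for
   [gen : q_generic v]. *)
Ltac qfield gen := rewrite /qint ?(opprD, opprK, intS, PoszD);
  rewrite ?(expfzDr _ _ (generic_neq0 gen), =^~ invr_expz, expr1z, expr0z);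
  field; rewrite ?oner_neq0 ?expfz_neq0 ?(generic_neq0 gen) ?(generic_sqr_neq1 gen) //.

(** * Identities for quantum integers and the recursion of idivided powers *)

Section IDividedPowers.
Variables (F : fieldType) (v : F).
Hypothesis gen : q_generic v.

Lemma qint_sqrD (a c : int) :
  qint v a ^+ 2 + qint v c ^+ 2
    + (v ^ (a + c) + v ^ (- (a + c))) * (qint v a * qint v c)
  = qint v (a + c) ^+ 2.
Proof. qfield gen. Qed.

(** With [a + c = N + 2], this splits the factor [[N+2][N+1]] of [iserre_rec] into three parts, one
    for each monomial [b^2 x], [x b^2], [b x b] of [ishift]. *)
Lemma qint_pairD (a c : int) :
  qint v a * qint v (a - 1) + qint v c * qint v (c - 1)
    + (v ^ (a + c - 1) + v ^ (- (a + c - 1))) * (qint v a * qint v c)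
  = qint v (a + c) * qint v (a + c - 1).
Proof. qfield gen. Qed.

Lemma sqr_sub_scalar_prod_comm (A : algType F) (b : A) (z : nat -> F) k :
  b * \prod_(1 <= j < k.+1) (b ^+ 2 - (z j)%:A)
  = (\prod_(1 <= j < k.+1) (b ^+ 2 - (z j)%:A)) * b.
Proof.
apply: commr_prod => j _; apply: commrB; first exact: commrX.
by rewrite /GRing.comm -scalerAr -scalerAl mulr1 mul1r.
Qed.

Lemma sqr_sub_scalar_prodS (A : algType F) (b : A) (z : nat -> F) k :
  b * (b * \prod_(1 <= j < k.+1) (b ^+ 2 - (z j)%:A))
  = \prod_(1 <= j < k.+2) (b ^+ 2 - (z j)%:A)
    + z k.+1 *: \prod_(1 <= j < k.+1) (b ^+ 2 - (z j)%:A).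
Proof.
rewrite [in RHS]big_nat_recr //= mulrBr -scalerAr mulr1 subrK.
by rewrite sqr_sub_scalar_prod_comm mulrA sqr_sub_scalar_prod_comm -mulrA.
Qed.

Lemma idivpow_even (A : algType F) (b : A) (p : 'Z_2) k :
  idivpow v b p k.*2 = (qfact v k.*2)^-1 *: \prod_(1 <= j < k.+1)
    (b ^+ 2 - (qint v (if p == 1 then 2 * j%:Z - 1 else 2 * j%:Z - 2) ^+ 2)%:A).
Proof. by rewrite /idivpow odd_double doubleK mul1r. Qed.

Lemma idivpow_odd (A : algType F) (b : A) (p : 'Z_2) k :
  idivpow v b p k.*2.+1 = (qfact v k.*2.+1)^-1 *: (b * \prod_(1 <= j < k.+1)
    (b ^+ 2 - (qint v (if p == 1 then 2 * j%:Z - 1 else 2 * j%:Z) ^+ 2)%:A)).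
Proof. by rewrite /idivpow /= odd_double /= uphalf_double. Qed.

Lemma idivpow_comm (A : algType F) (b : A) p n :
  b * idivpow v b p n = idivpow v b p n * b.
Proof.
rewrite -[n]odd_double_half; case: (odd n); rewrite ?add1n ?add0n.
  by rewrite idivpow_odd -scalerAr -scalerAl -mulrA sqr_sub_scalar_prod_comm.
by rewrite idivpow_even -scalerAr -scalerAl sqr_sub_scalar_prod_comm.
Qed.

(** If [n] has the parity of [p], the new factor [b^2 - z] is missing and writing
    [b^2 = (b^2 - z) + z] produces the second term; otherwise [b] times the power is already a
    multiple of the next one. At [n = 0] the meaningless predecessor is killed by [[0] = 0]. *)
Lemma idivpow_rec (A : algType F) (b : A) (p : 'Z_2) n :
  b * idivpow v b p n = qint v n.+1%:Z *: idivpow v b p n.+1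
    + ((odd n == (p == 1))%:R * qint v n%:Z) *: idivpow v b p n.-1.
Proof.
have qfK m : qint v m.+1%:Z * (qfact v m.+1)^-1 = (qfact v m)^-1.
  by rewrite qfactS invfM mulrCA divff ?gen.2 ?mulr1.
rewrite -[n]odd_double_half; set k := n./2.
case: (odd n) => /=; rewrite ?add0n ?add1n /= ?odd_double.
  rewrite idivpow_odd -doubleS !idivpow_even scalerA qfK -scalerAr.
  case: (p == 1); rewrite ?mul0r ?mul1r ?scale0r ?addr0.
    rewrite (sqr_sub_scalar_prodS b (fun j => qint v (2 * j%:Z - 1) ^+ 2)).
    rewrite scalerDr !scalerA; congr (_ + _ *: _).
    have -> : 2 * k.+1%:Z - 1 = k.*2.+1%:Z by lia.
    by rewrite -[in RHS]qfK mulrA -expr2 mulrC.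
  (* For even index and [p = 0] the first factor is [b^2 - [0]^2 = b^2]; splitting it off shifts the
     others to [b^2 - [2j]^2]. *)
  congr (_ *: _); rewrite [RHS]big_nat_recl //= mulr1 subrr qint0 expr0n /= scale0r subr0.
  rewrite mulrA -expr2; congr (_ * _); apply: eq_bigr => j _; congr (_ - (qint v _ ^+ 2)%:A).
  lia.
rewrite idivpow_even idivpow_odd scalerA qfK -scalerAr.
case p1: (p == 1); first by rewrite mul0r scale0r addr0.
case: k => [|k]; first by rewrite qint0 mulr0 scale0r addr0 !big_geq.
rewrite doubleS [k.*2.+2.-1]/= idivpow_odd p1 mul1r scalerA.
have -> : \prod_(1 <= j < k.+2) (b ^+ 2 - (qint v (2 * j%:Z - 2) ^+ 2)%:A)
          = b * (b * \prod_(1 <= j < k.+1) (b ^+ 2 - (qint v (2 * j%:Z) ^+ 2)%:A)).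
  rewrite big_nat_recl //= mulr1 subrr qint0 expr0n /= scale0r subr0.
  rewrite mulrA -expr2; congr (_ * _); apply: eq_bigr => j _; congr (_ - (qint v _ ^+ 2)%:A).
  lia.
rewrite (sqr_sub_scalar_prodS b (fun j => qint v (2 * j%:Z) ^+ 2)).
rewrite mulrDr scalerDr -scalerAr scalerA; congr (_ + _ *: _).
have -> : 2 * k.+1%:Z = k.*2.+2%:Z by lia.
by rewrite -[in RHS]qfK mulrA -expr2 mulrC.
Qed.
End IDividedPowers.

(** * Sums over pairs [a + c = N] *)

Section Antidiagonal.
Variable V : zmodType.
Implicit Types H : nat -> nat -> V.

Definition antidiag H N := \sum_(n < N.+1) H n (N - n)%N.

Lemma eq_antidiag H1 H2 N :
  (forall a c, (a + c)%N = N -> H1 a c = H2 a c) -> antidiag H1 N = antidiag H2 N.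
Proof. by move=> e; apply: eq_bigr => n _; apply: e; rewrite subnKC -1?ltnS. Qed.

Lemma antidiagD H1 H2 N :
  antidiag (fun a c => H1 a c + H2 a c) N = antidiag H1 N + antidiag H2 N.
Proof. exact: big_split. Qed.

Lemma antidiag_shiftl H N : (forall c, H 0%N c = 0) ->
  antidiag H N.+1 = antidiag (fun a c => H a.+1 c) N.
Proof. by move=> h; rewrite /antidiag big_ord_recl h add0r. Qed.

Lemma antidiag_shiftr H N : (forall a, H a 0%N = 0) ->
  antidiag H N.+1 = antidiag (fun a c => H a c.+1) N.
Proof.
move=> h; rewrite /antidiag big_ord_recr /= subnn h addr0.
by apply: eq_bigr => n _; rewrite subSn -1?ltnS.
Qed.

Lemma antidiag_transfer H1 H2 N :
    (forall c, H1 0%N c = 0) -> (forall a, H2 a 0%N = 0) ->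
    (forall a c, (a + c).+1 = N -> H1 a.+1 c = H2 a c.+1) ->
  antidiag H1 N = antidiag H2 N.
Proof.
move=> h1 h2 e; case: N e => [|N] e; first by rewrite /antidiag !big_ord1 subn0 h1 h2.
rewrite antidiag_shiftl // antidiag_shiftr //; apply: eq_antidiag => a c ac.
by apply: e; rewrite ac.
Qed.

End Antidiagonal.

Lemma antidiagZ (R : pzRingType) (V : lmodType R) k (H : nat -> nat -> V) N :
  k *: antidiag H N = antidiag (fun a c => k *: H a c) N.
Proof. exact: scaler_sumr. Qed.

(** * Reduction of the alternating sum from [N + 2] to [N] *)

Section ISerre.
Variables (F : fieldType) (v : F) (A : algType F).
Hypothesis gen : q_generic v.

Definition iserre (p' p : 'Z_2) (b : A) N (x : A) : A :=
  antidiag (fun a c => (-1) ^+ a * idivpow v b p' a * x * idivpow v b p c) N.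

(** The quadratic factor [Q_m] of the overview. *)
Definition ishift (b : A) (m : int) (x : A) : A :=
  b * (b * x) - (v ^ m + v ^ (- m)) *: (b * x * b) + x * b * b
  - (qint v m ^+ 2) *: x.

Lemma signr_scale a (x y z : A) : (-1) ^+ a * x * y * z = ((-1) ^+ a : F) *: (x * y * z).
Proof.
rewrite -signr_odd -[in RHS]signr_odd; case: (odd a); last by rewrite !expr0 mul1r scale1r.
by rewrite !expr1 scaleN1r mulN1r !mulNr.
Qed.

(** Of the consecutive indices [n] and [n + 1] exactly one has the parity of [p], so only one of the
    two applications of [idivpow_rec] has a correction term, and its scalar is [[n]^2] or [[n+1]^2]
    accordingly. *)
Lemma idivpow_rec2 (b : A) p n :
  b * (b * idivpow v b p n)
  = (qint v n.+1%:Z * qint v n.+2%:Z) *: idivpow v b p n.+2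
    + qint v (n + (odd n != (p == 1%R)))%N%:Z ^+ 2 *: idivpow v b p n.
Proof.
have := idivpow_rec gen b p; move: (idivpow v b p) => f fE.
rewrite fE mulrDr -!scalerAr fE scalerDr scalerA -addrA.
congr (_ + _); rewrite scalerA /=.
have [e|ne] := eqVneq (odd n) (p == 1); last first.
  have -> : (~~ odd n == (p == 1)) by move: ne; case: (odd n); case: (p == 1).
  by rewrite mul0r scale0r addr0 mul1r addn1 -expr2.
have -> : (~~ odd n == (p == 1)) = false by rewrite e; case: (p == 1).
rewrite mul0r mulr0 scale0r add0r mul1r addn0.
case: n e => [|n] e; first by rewrite qint0 expr0n !scale0r.
have ne : (odd n == (p == 1)) = false by rewrite -e /=; case: (odd n).
by rewrite fE ne mul0r scale0r addr0 scalerA -expr2.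
Qed.

(** Both sides are expanded in the terms [t a c]. Those with [a + c = N + 2] match by [qint_pairD];
    the corrections, with [a + c = N], cancel by [qint_sqrD]. *)
Lemma iserre_rec (b x : A) (p' p : 'Z_2) N :
    (p' == 1) = (odd N.+1 (+) (p == 1)) ->
  (qint v N.+2%:Z * qint v N.+1%:Z) *: iserre p' p b N.+2 x
  = iserre p' p b N (ishift b N.+1%:Z x).
Proof.
move=> pp.
set kap := v ^ N.+1%:Z + v ^ (- N.+1%:Z).
pose t a c : A := ((-1) ^+ a : F) *: (idivpow v b p' a * x * idivpow v b p c).
pose q (n : nat) := qint v n%:Z.
have q0 : q 0%N = 0 by rewrite /q qint0.
(* The truncated predecessor differs from [n - 1] only at [n = 0], where [[0] = 0]. *)
have qpred (n : nat) : q n * qint v (n%:Z - 1) = q n * q n.-1.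
  by case: n => [|n]; rewrite ?q0 ?mul0r //; congr (_ * qint v _); lia.
have E1 : (q N.+2 * q N.+1) *: iserre p' p b N.+2 x =
   antidiag (fun a c => (q a.+2 * q a.+1) *: t a.+2 c) N
   + antidiag (fun a c => (q c.+2 * q c.+1) *: t a c.+2) N
   + antidiag (fun a c => (kap * (q a.+1 * q c.+1)) *: t a.+1 c.+1) N.
  rewrite /iserre antidiagZ.
  have e : forall a c, (a + c)%N = N.+2 -> (q N.+2 * q N.+1) *:
     ((-1) ^+ a * idivpow v b p' a * x * idivpow v b p c) =
     (q a * q a.-1) *: t a c + (q c * q c.-1) *: t a c + (kap * (q a * q c)) *: t a c.
    move=> a c ac; rewrite signr_scale -/(t a c) -!scalerDl; congr (_ *: _).
    have acN : N.+1%:Z = a%:Z + c%:Z - 1 by lia.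
    have acN' : N.+2%:Z = a%:Z + c%:Z by lia.
    by rewrite -!qpred /kap /q acN acN' qint_pairD.
  rewrite (eq_antidiag e) !antidiagD.
  congr (_ + _ + _).
  - by rewrite !antidiag_shiftl // => c; rewrite /= ?q0 ?mulr0 ?mul0r scale0r.
  - by rewrite !antidiag_shiftr // => c; rewrite /= ?q0 ?mulr0 ?mul0r scale0r.
  - by rewrite antidiag_shiftl ?antidiag_shiftr // => c; rewrite ?q0 ?mulr0 ?mul0r ?mulr0 scale0r.
rewrite {}E1.
(* [d a] tells whether the recursion on the left factor has a correction at [a]. By [dc], the parity
   condition on [p'] makes the right factor have one exactly when the left has none. *)
pose d a := odd a == (p' == 1).
have dS a : d a.+1 = ~~ d a by rewrite /d /=; case: (odd a); case: (p' == 1).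
have dc a c : (a + c)%N = N -> (odd c == (p == 1)) = ~~ d a.
  by move=> ac; rewrite /d pp -ac /= oddD; case: (odd a); case: (odd c); case: (p == 1).
have E2 a c : (a + c)%N = N ->
   (-1) ^+ a * idivpow v b p' a * ishift b N.+1%:Z x * idivpow v b p c =
   (q a.+2 * q a.+1) *: t a.+2 c + (q c.+2 * q c.+1) *: t a c.+2
   + (kap * (q a.+1 * q c.+1)) *: t a.+1 c.+1
   + (q (a + ~~ d a)%N ^+ 2 + q (c + d a)%N ^+ 2 - q N.+1 ^+ 2) *: t a c
   + (kap * ((d a)%:R * q a * q c.+1)) *: t a.-1 c.+1
   + (kap * ((~~ d a)%:R * q a.+1 * q c)) *: t a.+1 c.-1.
  move=> ac; rewrite signr_scale /t /ishift -/kap -/(q _).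
  have := idivpow_rec gen b p' a; have := idivpow_rec2 b p' a.
  have := idivpow_comm v b p'.
  have := idivpow_rec gen b p c; have := idivpow_rec2 b p c.
  rewrite (dc _ _ ac) -/(d a) -!/(q _).
  move: (idivpow v b p') (idivpow v b p) => f g gE2 gE fC fE2 fE.
  have L1 : f a * (b * (b * x)) * g c = b * (b * f a) * x * g c.
    by rewrite !mulrA -fC -[b * f a * b]mulrA -fC !mulrA.
  have L2 : f a * (b * x * b) * g c = b * f a * x * (b * g c) by rewrite !mulrA fC.
  have L3 : f a * (x * b * b) * g c = f a * x * (b * (b * g c)) by rewrite !mulrA.
  have eps2 : (-1) ^+ a.+2 = (-1) ^+ a :> F by rewrite !exprS mulrA mulrNN !mul1r.
  have eps1 : (-1) ^+ a.+1 = - (-1) ^+ a :> F by rewrite exprS mulN1r.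
  have sC (k : F) (y : A) : k *: ((-1) ^+ a *: y) = (-1) ^+ a *: (k *: y).
    by rewrite !scalerA mulrC.
  have sNC (k : F) (y : A) : k *: (- (-1) ^+ a *: y) = (-1) ^+ a *: (- (k *: y)).
    by rewrite scaleNr !scalerN sC.
  (* Lowering [a] by one flips the sign, except at [a = 0], where the coefficient [[0]] vanishes. *)
  have eps0 (k l : F) (y : A) :
      (k * (q a * l)) *: ((-1) ^+ a.-1 *: y) = (-1) ^+ a *: (- ((k * (q a * l)) *: y)).
    case: (a) => [|a']; first by rewrite q0 !(mul0r, mulr0, scale0r) oppr0 scaler0.
    by rewrite exprS mulN1r scaleNr !scalerN opprK !scalerA mulrC.
  clearbody kap.
  rewrite !(mulrBr, mulrDr, mulrBl, mulrDl) -!scalerAr -!scalerAl L1 L2 L3 fE2 gE2 fE gE.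
  rewrite eps1 eps2.
  rewrite [q a.+2 * _]mulrC [q c.+2 * _]mulrC.
  case: (d a) => /=; rewrite !(mul1r, mul0r, mulr0, scale0r, addr0, add0r) ?eps0.
    rewrite sNC !sC -!scalerDr; congr (_ *: _).
    rewrite !(mulrDl, mulrDr, scalerDl, scalerDr, scalerBl) -!scalerAl -!scalerAr.
    by rewrite !scalerA !mulrA opprD !scaleNr !addrA [LHS](ACl (1*5*3*2*6*7*4)).
  rewrite !sNC !sC -!scalerDr; congr (_ *: _).
  rewrite !(mulrDl, mulrDr, scalerDl, scalerDr, scalerBl) -!scalerAl -!scalerAr.
  by rewrite !scalerA !mulrA opprD !scaleNr !addrA [LHS](ACl (1*5*3*2*6*7*4)).
rewrite /iserre (eq_antidiag E2) !antidiagD; apply/esym.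
rewrite -[RHS]addr0 -!addrA; do 3!congr (_ + _).
(* The two mixed corrections are moved one place along the antidiagonal, so that all corrections
   become multiples of the same [t a c] and cancel term by term. *)
rewrite [X in _ + (X + _)](antidiag_transfer
  (H2 := fun a c => (kap * ((~~ d a)%:R * q a.+1 * q c)) *: t a c)); first last.
- by move=> a c _; rewrite dS.
- by move=> a; rewrite q0 !mulr0 scale0r.
- by move=> c; rewrite q0 mulr0 mul0r mulr0 scale0r.
rewrite -[X in _ + (_ + X)](antidiag_transfer
  (H1 := fun a c => (kap * ((d a)%:R * q a * q c.+1)) *: t a c)); first last.
- by move=> a c _; rewrite dS.
- by move=> a; rewrite q0 !mulr0 scale0r.
- by move=> c; rewrite q0 mulr0 mul0r mulr0 scale0r.
rewrite -!antidiagD; apply/big1 => n _; rewrite -!scalerDl.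
set c := (N - n)%N; have : (n + c)%N = N by rewrite subnKC -1?ltnS.
move: (nat_of_ord n) c => {}n c nc; apply/eqP; rewrite scaler_eq0; apply/orP; left; apply/eqP.
case: (d n); rewrite /= !(mul1r, mul0r, mulr0, addr0, add0r, addn0, addn1).
  rewrite addrAC /q /kap.
  have -> : N.+1%:Z = n%:Z + c.+1%:Z by lia.
  by rewrite qint_sqrD // subrr.
rewrite addrAC /q /kap.
have -> : N.+1%:Z = n.+1%:Z + c%:Z by lia.
by rewrite qint_sqrD // subrr.
Qed.

End ISerre.

(** * Vanishing of the alternating sum on three-term sequences *)

Section Chain.
Variables (F : fieldType) (v : F) (A : algType F).
Hypothesis gen : q_generic v.

(** The three-term relation of the overview with [N = m + 1], for an arbitrary sequence so that the
    induction can replace [X] by [chain_shift]. The value [X k.-1] at [k = 0] has coefficient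
    zero. *)
Definition is_chain (b : A) N (X : nat -> A) : Prop :=
  X N = 0 /\ forall k : nat,
    b * X k = v ^ (k%:Z + k%:Z - N%:Z + 1) *: (X k * b) + X k.+1
      + (v ^ (k%:Z + k%:Z - N%:Z) * (qint v k%:Z * qint v (N%:Z - k%:Z))) *: X k.-1.

(* The sequence for [N] whose initial term is [ishift b N.+1 (X 0)], when [X] is a
   chain for [N.+2]. *)
Definition chain_shift (b : A) N (X : nat -> A) k : A :=
  X k.+2 + (v ^ (k%:Z + k%:Z + 1 - N%:Z) - v ^ (N%:Z + 1)) *: (X k.+1 * b)
  - (v ^ (k%:Z + k%:Z + 1) * (qint v (N%:Z + 1 - k%:Z) * qint v (N%:Z - k%:Z))) *: X k.

Lemma ishift_chain (b : A) N X : is_chain b N.+2 X ->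
  ishift v b N.+1%:Z (X 0%N) = chain_shift b N X 0.
Proof.
case=> _ bX; have := bX 0%N; have := bX 1%N; rewrite /= qint0 mul0r mulr0 scale0r addr0.
move=> b1 b0; rewrite /ishift b0 mulrDr -scalerAr mulrA b0 b1 /chain_shift.
rewrite !mulrDl -!scalerAl !scalerDr !scalerA !addrA opprD !addrA -!scaleNr.
rewrite [LHS](ACl ((1*6*8)*4*(2*3*7)*(5*9))) /= -!scalerDl.
rewrite -[X in _ *: _ + X + _ + _ + _]scale1r -scalerDl.
(* The terms are grouped by monomial; the coefficient of [X 0 * b * b] vanishes. *)
rewrite [X in X *: (_ * b * b)](_ : _ = 0) ?scale0r ?add0r; last by qfield gen.
congr (_ + _ *: _ + _ *: _); qfield gen.
Qed.

(** At [k = N] each of the three terms of [chain_shift] vanishes separately. The relation follows by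
    moving [b] through each term and comparing the coefficients of six monomials. *)
Lemma chain_shift_chain (b : A) N X : is_chain b N.+2 X ->
  is_chain b N (chain_shift b N X).
Proof.
case=> XN bX; split=> [|k].
  rewrite /chain_shift XN add0r [N%:Z - _]subrr qint0 !mulr0 scale0r subr0.
  have -> : N%:Z + N%:Z + 1 - N%:Z = N%:Z + 1 by lia.
  by rewrite subrr scale0r.
(* This replaces [k.-1] by the integer [k - 1] in the exponents; at [k = 0] both sides carry the
   factor [[0]]. *)
have -> : (v ^ (k%:Z + k%:Z - N%:Z) * (qint v k%:Z * qint v (N%:Z - k%:Z)))
    *: chain_shift b N X k.-1 =
  (v ^ (k%:Z + k%:Z - N%:Z) * (qint v k%:Z * qint v (N%:Z - k%:Z)))
    *: (X k.+1 + (v ^ (k%:Z + k%:Z - 1 - N%:Z) - v ^ (N%:Z + 1)) *: (X k * b)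
  - (v ^ (k%:Z + k%:Z - 1) * (qint v (N%:Z + 2 - k%:Z) * qint v (N%:Z + 1 - k%:Z))) *: X k.-1).
  case: k => [|k]; first by rewrite qint0 mul0r mulr0 !scale0r.
  congr (_ *: (_ + (v ^ _ - _) *: _ - (v ^ _ * (qint v _ * qint v _)) *: _)); rewrite /=; lia.
rewrite /chain_shift mulrBr mulrDr -!scalerAr mulrA !bX.
rewrite !(mulrBl, mulrDl) -!scalerAl !(scalerDr, scalerBr) !scalerA !opprD !addrA /=.
rewrite -!scaleNr !scalerA.
rewrite [LHS](ACl ((1*5)*2*(3*8)*4*(6*7)*9)) [RHS](ACl ((1*5)*4*(6*7)*2*(3*8)*9)) /=.
rewrite -!scalerDl.
congr (_ *: _ + _ + _ *: _ + _ *: _ + _ *: _ + _ *: _); qfield gen.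
Qed.

(** Induction in steps of two, cancelling [[N+2][N+1]]. For [N = 0] the term [X 0] is zero; for
    [N = 1] the relation at [k = 0] says that [b] commutes with [X 0]. *)
Lemma iserre_chain (b : A) (p' p : 'Z_2) N X :
  (p' == 1) = (odd N.+1 (+) (p == 1)) -> is_chain b N X -> iserre v p' p b N (X 0%N) = 0.
Proof.
elim/ltn_ind: N X => -[|[|N]] IHN X pp chX.
- by rewrite /iserre /antidiag big_ord1 chX.1 mulr0 mul0r.
- case: chX => X1 /(_ 0%N); rewrite X1 qint0 mul0r mulr0 scale0r !addr0.
  have -> : 0%:Z + 0%:Z - 1%:Z + 1 = 0 by [].
  rewrite expr0z scale1r => bX.
  rewrite /iserre /antidiag !big_ord_recl big_ord0 /= /idivpow /= !big_geq // !mulr1.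
  rewrite expr0 expr1 !mul1r addr0 -!scalerAl -!scalerAr scalerA /=.
  rewrite /bump /= mulr1 !mul1r. by rewrite mulN1r -scalerAl mulNr bX !scalerN scalerA addrN.
have nz : qint v N.+2%:Z * qint v N.+1%:Z != 0 by rewrite mulf_neq0 ?gen.2.
apply: (scalerI nz); rewrite scaler0 iserre_rec //; last by rewrite pp /= !negbK.
rewrite ishift_chain //; apply: IHN => //; last exact: chain_shift_chain.
by rewrite pp /= !negbK.
Qed.
End Chain.

(** * Iterated q-commutators and the Serre relation *)

Section QAdjoint.
Variables (F : fieldType) (v : F) (A : algType F).
Hypothesis gen : q_generic v.

Lemma qcomm_inv (K K' y : A) (s : F) : K * K' = 1 -> K' * K = 1 -> s != 0 ->
  K * y = s *: (y * K) -> K' * y = s^-1 *: (y * K').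
Proof.
move=> KK' K'K s0 Ky; have -> : y * K' = K' * (K * y) * K' by rewrite mulrA K'K mul1r.
by rewrite Ky -scalerAr -scalerAl -!mulrA KK' mulr1 scalerA mulVf ?scale1r.
Qed.

Lemma qcommX (K y : A) (s : F) n : K * y = s *: (y * K) ->
  K ^+ n * y = s ^+ n *: (y * K ^+ n).
Proof.
move=> Ky; elim: n => [|n IHn]; first by rewrite !expr0 mul1r mulr1 scale1r.
by rewrite [in LHS]exprSr -mulrA Ky -scalerAr mulrA IHn -scalerAl scalerA -exprS -mulrA -exprSr.
Qed.

Lemma qcommM (K y z : A) (s t : F) : K * y = s *: (y * K) -> K * z = t *: (z * K) ->
  K * (y * z) = (s * t) *: (y * z * K).
Proof.
move=> Ky Kz.
by rewrite mulrA Ky -scalerAl -[y * K * z]mulrA Kz -scalerAr scalerA mulrA.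
Qed.

Lemma qcommXr (K y : A) (s : F) n : K * y = s *: (y * K) ->
  K * y ^+ n = s ^+ n *: (y ^+ n * K).
Proof.
move=> Ky; elim: n => [|n IHn]; first by rewrite !expr0 mul1r mulr1 scale1r.
by rewrite !exprS; apply: qcommM.
Qed.

Lemma qbinom_fact m n : (n <= m)%N ->
  qbinom v m%:Z n%:Z = qfact v m / (qfact v n * qfact v (m - n)).
Proof.
move=> nm; rewrite /qbinom; have nz := qfact_neq0 gen.
suff -> : \prod_(i < n) qint v (m%:Z - i%:Z) = qfact v m / qfact v (m - n).
  by rewrite invfM mulrA mulrAC.
elim: n nm => [|n IHn] nm; first by rewrite big_ord0 subn0 divff.
rewrite big_ord_recr /= IHn 1?ltnW //.
have -> : (m - n = (m - n.+1).+1)%N by lia.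
have -> : m%:Z - n%:Z = (m - n.+1).+1%:Z by lia.
by rewrite qfactS invfM -!mulrA mulVf ?gen.2 // mulr1.
Qed.

Variables (m : nat) (E G K K' x : A).

(** The sequence [X_k] of the overview, with [G] in the role of [F_i]. *)
Fixpoint qad k : A :=
  if k is j.+1 then G * qad j - v ^ (j%:Z + j%:Z - m%:Z) *: (qad j * G) else x.

Definition qdp (n : nat) : A := (qfact v n)^-1 *: G ^+ n.

Lemma qdp_mull a c : G * (qdp a * x * qdp c) = qint v a.+1%:Z *: (qdp a.+1 * x * qdp c).
Proof.
rewrite !mulrA [RHS]scalerAl [in RHS]scalerAl; congr (_ * _ * _).
by rewrite /qdp -scalerAr -exprS scalerA qfactS invfM mulrCA divff ?gen.2 // mulr1.
Qed.

Lemma qdp_mulr a c : qdp a * x * qdp c * G = qint v c.+1%:Z *: (qdp a * x * qdp c.+1).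
Proof.
rewrite -[LHS]mulrA [RHS]scalerAr; congr (_ * _).
by rewrite /qdp -scalerAl -exprSr scalerA qfactS invfM mulrCA divff ?gen.2 // mulr1.
Qed.

(** A quantum binomial expansion in ordinary divided powers of [G]. At [k = m + 1] the exponent of
    [v] is zero, which leaves the Serre sum. *)
Lemma qad_dp k : qad k = qfact v k *: antidiag (fun a c =>
   ((-1) ^+ c * v ^ (c%:Z * (k%:Z - 1 - m%:Z))) *: (qdp a * x * qdp c)) k.
Proof.
elim: k => [|k IHk].
  rewrite /antidiag big_ord1 /= mul0r expr0z !mul1r scale1r /qdp /qfact big_geq //.
  by rewrite invr1 !scale1r expr0 mul1r mulr1.
set e := k%:Z - 1 - m%:Z in IHk.
pose t a c := qdp a * x * qdp c.
rewrite /= IHk -scalerAr -scalerAl scalerA qfactS -[RHS]scalerA.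
rewrite [_ * qfact v k]mulrC -scalerA -scalerBr; congr (_ *: _).
(* Multiplication by [G] raises one index, so both products are sums over the antidiagonal [k + 1];
   the added boundary terms carry [[0]]. *)
have -> : G * antidiag (fun a c => ((-1) ^+ c * v ^ (c%:Z * e)) *: t a c) k
    = antidiag (fun a c => (qint v a%:Z * ((-1) ^+ c * v ^ (c%:Z * e))) *: t a c) k.+1.
  rewrite [RHS]antidiag_shiftl => [|c]; last by rewrite qint0 !mul0r scale0r.
  rewrite /antidiag mulr_sumr; apply: eq_bigr => n _.
  by rewrite -scalerAr qdp_mull scalerA mulrC.
have -> : antidiag (fun a c => ((-1) ^+ c * v ^ (c%:Z * e)) *: t a c) k * G
    = antidiag (fun a c =>
        (qint v c%:Z * ((-1) ^+ c.-1 * v ^ (c.-1%:Z * e))) *: t a c) k.+1.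
  rewrite [RHS]antidiag_shiftr => [|a]; last by rewrite qint0 !mul0r scale0r.
  rewrite /antidiag mulr_suml; apply: eq_bigr => n _.
  by rewrite -scalerAl qdp_mulr scalerA mulrC.
rewrite !antidiagZ /antidiag -sumrB; apply: eq_bigr => n _.
set c := (k.+1 - n)%N; have : (n + c)%N = k.+1 by rewrite subnKC -1?ltnS.
move: (nat_of_ord n) c => a c ac.
rewrite !scalerA -scalerBl /e; congr (_ *: _); case: c ac => [|c] /= ac.
  by rewrite qint0 !mul0r mulr0 subr0 expr0z !mulr1 -ac addn0.
have -> : k%:Z = a%:Z + c%:Z by lia.
have -> : k.+1%:Z = a%:Z + c%:Z + 1 by lia.
(* The nonlinear part of both exponents is isolated, so that it can be treated as an atom below. *)
have -> : c.+1%:Z * (a%:Z + c%:Z - 1 - m%:Z) =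
  c%:Z * (a%:Z + c%:Z - 1 - m%:Z) + (a%:Z + c%:Z - 1 - m%:Z) by rewrite intS; ring.
have -> : c.+1%:Z * (a%:Z + c%:Z + 1 - 1 - m%:Z) =
  c%:Z * (a%:Z + c%:Z - 1 - m%:Z) + (a%:Z + c%:Z + c%:Z - m%:Z) by rewrite intS; ring.
rewrite exprS; move: (c%:Z * _) ((-1) ^+ c) => i s.
qfield gen.
Qed.

Lemma qad_serre : qad m.+1 = (-1) ^+ m.+1 *: serre v m.+1 G x.
Proof.
rewrite qad_dp /serre -/(antidiag (fun a c => _) _) /antidiag !scaler_sumr.
apply: eq_bigr => n _; have nm : (n <= m.+1)%N by rewrite -ltnS.
rewrite (_ : m.+1%:Z - 1 - m%:Z = 0); last by lia.
rewrite mulr0 expr0z mulr1 qbinom_fact // scalerA /qdp -!scalerAl -scalerAr !scalerA.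
congr (_ *: _); rewrite mulrA -exprD.
have -> : (-1) ^+ (m.+1 + n) = (-1) ^+ (m.+1 - n) :> F.
  by rewrite -signr_odd oddD -oddB // signr_odd.
by rewrite invfM !mulrA [qfact v m.+1 * _]mulrC.
Qed.

Hypothesis KK' : K * K' = 1.
Hypothesis K'K : K' * K = 1.
Hypothesis KG : K * G = v ^ (- 2%:Z) *: (G * K).
Hypothesis EG : E * G - G * E = (v - v^-1)^-1 *: (K - K').
Hypothesis Ex : E * x = x * E.
Hypothesis Kx : K * x = v ^ m%:Z *: (x * K).

Lemma K_qad k : K * qad k = v ^ (m%:Z - k%:Z - k%:Z) *: (qad k * K).
Proof.
elim: k => [|k IHk]; first by rewrite /= !subr0.
rewrite [qad _]/= mulrBr mulrBl -scalerAr -scalerAl !mulrA IHk KG.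
rewrite -!scalerAl -!mulrA IHk KG -!scalerAr !scalerA scalerBr scalerA.
by congr (_ *: _ - _ *: _); qfield gen.
Qed.

Lemma K'_qad k : K' * qad k = v ^ (k%:Z + k%:Z - m%:Z) *: (qad k * K').
Proof.
rewrite (qcomm_inv KK' K'K _ (K_qad k)) ?expfz_neq0 ?generic_neq0 //.
by rewrite invr_expz; congr (v ^ _ *: _); lia.
Qed.

(** As for a lowering operator in rank one: in the induction the [K'] terms and the [y * G * K]
    terms cancel, and [[k][m+1-k] + [m-2k] = [k+1][m-k]]. *)
Lemma E_qad k : E * qad k
  = qad k * E + (qint v k%:Z * qint v (m%:Z + 1 - k%:Z)) *: (qad k.-1 * K).
Proof.
elim: k => [|k IHk]; first by rewrite qint0 mul0r scale0r addr0.
have EG' : E * G = G * E + (v - v^-1)^-1 *: (K - K') by rewrite -EG addrC subrK.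
set cc := qint v _ * _ in IHk; set y := qad k.-1 in IHk; set d := (v - v^-1)^-1 in EG'.
have EGx : E * (G * qad k) = G * qad k * E + cc *: (G * y * K)
    + (d * v ^ (m%:Z - k%:Z - k%:Z)) *: (qad k * K)
    - (d * v ^ (k%:Z + k%:Z - m%:Z)) *: (qad k * K').
  rewrite mulrA EG' mulrDl -mulrA IHk mulrDr -scalerAr !mulrA -!(@addrA A); congr (_ + (_ + _)).
  by rewrite -scalerAl mulrBl K_qad K'_qad scalerBr !scalerA.
have ExG : E * (qad k * G) = qad k * G * E + d *: (qad k * K) - d *: (qad k * K')
    + (cc * v ^ (- 2%:Z)) *: (y * G * K).
  rewrite mulrA IHk mulrDl -mulrA EG' mulrDr mulrA -scalerAr mulrBr scalerBr addrA.
  by congr (_ + _); rewrite -scalerAl -[y * K * G]mulrA KG -scalerAr scalerA mulrA.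
have GyK : cc *: (G * y * K)
    = cc *: (qad k * K) + (cc * v ^ (k%:Z + k%:Z - 2 - m%:Z)) *: (y * G * K).
  rewrite /cc /y; case: (k) => [|j]; first by rewrite qint0 mul0r !scale0r mul0r scale0r addr0.
  rewrite /= mulrBl scalerBr -scalerAl scalerA.
  rewrite (_ : j.+1%:Z + j.+1%:Z - 2 - m%:Z = j%:Z + j%:Z - m%:Z); last by lia.
  by rewrite subrK.
rewrite [qad k.+1]/= [k.+1.-1]/= mulrBr mulrBl -scalerAr -scalerAl EGx ExG GyK.
rewrite !(scalerDr, scalerBr) !scalerA !opprD -!scaleNr !addrA.
rewrite !scalerA [LHS](ACl (1*6*(2*4*7)*(3*9)*(5*8))) /= -!scalerDl /cc /d.
rewrite [X in X *: (y * G * K)](_ : _ = 0); last by qfield gen.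
rewrite [X in X *: (_ * K')](_ : _ = 0); last by qfield gen.
by rewrite !scale0r !addr0; congr (_ + _ *: _); qfield gen.
Qed.

(** The summand [G] yields the next term by definition of [qad]; in [E * K'] the factor [K'] cancels
    the [K] of [E_qad] and yields the previous term. *)
Lemma qad_chain : serre v m.+1 G x = 0 -> is_chain v (G + v^-1 *: (E * K')) m.+1 qad.
Proof.
move=> xS; split=> [|k]; first by rewrite qad_serre xS scaler0.
rewrite mulrDl mulrDr -scalerAl -scalerAr -[E * K' * _]mulrA K'_qad -scalerAr mulrA E_qad.
rewrite mulrDl -scalerAl -[qad k.-1 * K * K']mulrA KK' mulr1 /= scalerDr !scalerA scalerDr.
rewrite (_ : k%:Z + k%:Z - m.+1%:Z + 1 = k%:Z + k%:Z - m%:Z); last by lia.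
rewrite (_ : m.+1%:Z - k%:Z = m%:Z + 1 - k%:Z); last by lia.
rewrite (_ : k%:Z + k%:Z - m.+1%:Z = -1 + (k%:Z + k%:Z - m%:Z)); last by lia.
rewrite (expfzDr (-1) _ (generic_neq0 gen)) exprN1 !scalerA [in RHS]scalerDr !scalerA !mulrA.
rewrite [_ * v^-1]mulrC !(@addrA A).
by rewrite [RHS](ACl (3*2*5*(1*4))) /= subrr addr0.
Qed.

Lemma iserre_serre (p' p : 'Z_2) : (p' == 1) = (odd m (+) (p == 1)) ->
  serre v m.+1 G x = 0 -> iserre v p' p (G + v^-1 *: (E * K')) m.+1 x = 0.
Proof.
move=> pp xS; apply: (iserre_chain gen _ (qad_chain xS)).
by rewrite pp /= negbK.
Qed.
End QAdjoint.

(** * The second summand of [B_j], by a symmetry inverting [v] *)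

Lemma iserre_inv (F : fieldType) (v : F) (A : algType F) (p' p : 'Z_2) (b x : A) N :
  iserre v^-1 p' p b N x = iserre v p' p b N x.
Proof. by apply: eq_antidiag => a c _; rewrite !idivpow_inv. Qed.

(* [G' = v^-1 E K'] and [v^-1 G K] satisfy the relations of [G] and [E] for the
   parameter [v^-1], and [b = G + v^-1 E K'] is the same for both. *)
Section Twist.
Variables (F : fieldType) (v : F) (A : algType F) (m : nat) (E G K K' e L : A).
Hypothesis gen : q_generic v.
Hypothesis KK' : K * K' = 1.
Hypothesis K'K : K' * K = 1.
Hypothesis KE : K * E = v ^ 2%:Z *: (E * K).
Hypothesis KG : K * G = v ^ (- 2%:Z) *: (G * K).
Hypothesis EG : E * G - G * E = (v - v^-1)^-1 *: (K - K').
Hypothesis Ge : G * e = e * G.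
Hypothesis Ke : K * e = v ^ (- m%:Z) *: (e * K).
Hypothesis LE : L * E = v ^ m%:Z *: (E * L).
Hypothesis LG : L * G = v ^ (- m%:Z) *: (G * L).
Hypothesis KL : K * L = L * K.

Let G' := v^-1 *: (E * K').
(** Normal form of [G' ^+ a * (e * L) * G' ^+ c], up to a scalar. Multiplying by [G'] on either side
    costs the same scalar [kap (a + c)], so the total depends on [a + c] only and factors out of the
    Serre sum. *)
Let W a c := E ^+ a * e * E ^+ c * K' ^+ (a + c) * L.
Let kap (j : nat) := v ^ (m%:Z - 1 - (j%:Z + j%:Z)).

Lemma K'E : K' * E = v ^ (- 2%:Z) *: (E * K').
Proof. by rewrite (qcomm_inv KK' K'K _ KE) ?expfz_neq0 ?generic_neq0 // invr_expz. Qed.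

Lemma K'G : K' * G = v ^ 2%:Z *: (G * K').
Proof. by rewrite (qcomm_inv KK' K'K _ KG) ?expfz_neq0 ?generic_neq0 // invr_expz. Qed.

Lemma K'e : K' * e = v ^ m%:Z *: (e * K').
Proof. by rewrite (qcomm_inv KK' K'K _ Ke) ?expfz_neq0 ?generic_neq0 // invr_expz opprK. Qed.

Lemma K'L : K' * L = L * K'.
Proof. by rewrite -[K' * L]mulr1 -KK' !mulrA -[K' * L * K]mulrA -KL mulrA K'K mul1r. Qed.

Let W_K' a c : W a c * K' = E ^+ a * e * E ^+ c * K' ^+ (a + c).+1 * L.
Proof. by rewrite /W -mulrA -K'L mulrA -[_ * K' ^+ _ * K']mulrA -exprSr. Qed.

Let exprVz n : (v ^ (- 2%:Z)) ^+ n = v ^ (- (n%:Z + n%:Z)).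
Proof. by rewrite -[LHS]/((v ^ (- 2%:Z)) ^ n%:Z) exprz_exp; congr (v ^ _); lia. Qed.

Lemma twist_mull a c : G' * W a c = kap (a + c) *: W a.+1 c.
Proof.
have K'W : K' * W a c = v ^ (m%:Z - (a%:Z + c%:Z + (a%:Z + c%:Z))) *: (W a c * K').
  have K'K'X n : K' * K' ^+ n = 1 *: (K' ^+ n * K') by rewrite scale1r -exprS exprSr.
  have K'L1 : K' * L = 1 *: (L * K') by rewrite scale1r K'L.
  rewrite /W (qcommM (qcommM (qcommM (qcommM (qcommXr a K'E) K'e) (qcommXr c K'E)) (K'K'X _)) K'L1).
  by rewrite !mulr1 !exprVz -!expfzDr ?generic_neq0 //; congr (v ^ _ *: _); lia.
rewrite /G' -scalerAl -mulrA K'W W_K' -scalerAr scalerA.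
have -> : W a.+1 c = E * (E ^+ a * e * E ^+ c * K' ^+ (a + c).+1 * L).
  by rewrite /W addSn !mulrA -exprS.
congr (_ *: _); rewrite -[v^-1]exprN1 -expfzDr ?generic_neq0 // /kap; congr (v ^ _); lia.
Qed.

Lemma twist_mulr a c : W a c * G' = kap (a + c) *: W a c.+1.
Proof.
have -> : W a c * G' = v^-1 *: (E ^+ a * e * E ^+ c * (K' ^+ (a + c) * L * E) * K').
  by rewrite /G' -scalerAr /W !mulrA.
have -> : K' ^+ (a + c) * L * E = (v ^ m%:Z * v ^ (- ((a + c)%N%:Z + (a + c)%N%:Z)))
    *: (E * K' ^+ (a + c) * L).
  by rewrite -mulrA LE -scalerAr mulrA (qcommX _ K'E) exprVz -scalerAl scalerA.
have -> : W a c.+1 = E ^+ a * e * E ^+ c * (E * K' ^+ (a + c) * L) * K'.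
  by rewrite /W addnS exprSr (exprSr K') !mulrA -[_ * L * K']mulrA -K'L !mulrA.
rewrite -scalerAr -scalerAl scalerA; congr (_ *: _).
rewrite -[v^-1]exprN1 -!expfzDr ?generic_neq0 // /kap; congr (v ^ _); lia.
Qed.

Lemma twist_exp n j :
  G' ^+ n * (e * L) * G' ^+ j = \prod_(i < n + j) kap i *: W n j.
Proof.
elim: n => [|n IHn]; last first.
  rewrite exprS -[_ * (e * L)]mulrA -[_ * G' ^+ j]mulrA IHn -scalerAr twist_mull.
  by rewrite scalerA addSn big_ord_recr.
rewrite expr0 mul1r; elim: j => [|j IHj].
  by rewrite big_ord0 scale1r /W !expr0 !(mul1r, mulr1).
by rewrite exprSr mulrA IHj -scalerAl twist_mulr scalerA addnS big_ord_recr.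
Qed.

Lemma twist_serre : serre v m.+1 E e = 0 -> serre v^-1 m.+1 G' (e * L) = 0.
Proof.
move=> eS; have -> : serre v^-1 m.+1 G' (e * L)
    = \prod_(i < m.+1) kap i *: (serre v m.+1 E e * K' ^+ m.+1 * L); last first.
  by rewrite eS !mul0r scaler0.
rewrite /serre !mulr_suml scaler_sumr; apply: eq_bigr => n _.
have nm : (n <= m.+1)%N by rewrite -ltnS.
rewrite twist_exp subnKC // /W subnKC // -!scalerAl !scalerA [RHS]/=; congr (_ *: _).
rewrite mulrC; congr (_ * (_ * _)).
rewrite /qbinom qfact_inv; congr (_ / _); apply: eq_bigr => i _; exact: qint_inv.
Qed.

Lemma iserre_twist (p' p : 'Z_2) : (p' == 1) = (odd m (+) (p == 1)) ->
  serre v m.+1 E e = 0 -> iserre v p' p (G + v^-1 *: (E * K')) m.+1 (e * L) = 0.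
Proof.
move=> pp eS.
have gen' : q_generic v^-1 by exact: q_generic_inv.
have vz (n : int) : v^-1 ^ n = v ^ (- n) by rewrite exprz_inv.
have := @iserre_serre _ v^-1 A gen' m (v^-1 *: (G * K)) G' K K' (e * L).
move=> /(_ KK' K'K _ _ _ _ _ _ pp (twist_serre eS)) H.
have v0 := generic_neq0 gen.
(* The exchange only swaps the two summands of [b]. *)
have bE : G' + v^-1^-1 *: (v^-1 *: (G * K) * K') = G + v^-1 *: (E * K').
  by rewrite invrK -scalerAl scalerA divff // scale1r -mulrA KK' mulr1 addrC.
rewrite -[RHS]H ?iserre_inv ?bE //.
- rewrite vz opprK /G' -scalerAr -scalerAl mulrA KE -scalerAl -!mulrA KK' K'K.
  by rewrite scalerA mulrC -scalerA.
- rewrite /G' -!scalerAl -!scalerAr !scalerA -scalerBr !mulrA -[G * K * E]mulrA KE.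
  rewrite -[E * K' * G]mulrA K'G -!scalerAr -!scalerAl -!mulrA KK' K'K !mulr1 -scalerBr scalerA.
  rewrite -[G * E - _]opprB EG scalerN -scaleNr scalerA invrK; congr (_ *: _).
  rewrite -[v^-1 - v]opprB invrN mulNr; congr (- _).
  by rewrite -!exprN1 -!expfzDr // mul1r.
- rewrite -scalerAl -scalerAr; congr (_ *: _).
  rewrite !mulrA -[G * K * e]mulrA Ke -[e * L * G]mulrA LG -!scalerAr -!scalerAl.
  by rewrite !mulrA Ge -[_ * K * L]mulrA KL mulrA.
- by rewrite vz mulrA Ke -scalerAl -!mulrA KL.
Qed.
End Twist.

(** * Genericity of the powers of the indeterminate *)

Lemma q_generic_exp (F : fieldType) (q : F) e : q != 0 ->
  (forall n, q ^+ n.+1 != 1) -> (0 < e)%N -> q_generic (q ^+ e).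
Proof.
move=> q0 q1 e0; have v0 : q ^+ e != 0 by rewrite expf_neq0.
have vn n : (q ^+ e) ^ n.+1%:Z - (q ^+ e) ^ (- n.+1%:Z) != 0.
  (* If [v^(n+1) = v^-(n+1)] for [v = q^e], then [q] to the power [2e(n+1) > 0] is 1. *)
  rewrite -invr_expz subr_eq0; apply: contraNneq (q1 (e * (n.+1 + n.+1)).-1) => vE.
  rewrite prednK ?muln_gt0 ?e0 // exprM exprD.
  by rewrite -[X in X * _]/(_ ^ n.+1%:Z) {1}vE mulVf // expf_neq0.
split=> // n; rewrite /qint mulf_neq0 ?vn // invr_eq0.
by have := vn 0%N; rewrite -invr_expz expr1z.
Qed.

Lemma qvar_neq0 (K : fieldType) : qvar K != 0.
Proof. by rewrite /qvar tofrac_eq0 polyX_eq0. Qed.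

Lemma qvar_exp_neq1 (K : fieldType) n : qvar K ^+ n.+1 != 1.
Proof.
rewrite /qvar -rmorphXn -(rmorph1 (@tofrac {poly K})) tofrac_eq.
by apply/eqP => /(congr1 (fun p : {poly K} => size p)); rewrite size_polyXn size_poly1.
Qed.

(** * Cartan integers *)

Section RootDatum.
Variables (I : finType) (C : cartanDatum I) (D : rootDatum C).

Lemma cdot_eps i : C i i = 2 * (eps C i)%:Z.
Proof. by have /andP[] := cdot_diag C i; rewrite /eps; lia. Qed.

Lemma eps_gt0 i : (0 < eps C i)%N.
Proof. by have /andP[+ _] := cdot_diag C i; rewrite cdot_eps; lia. Qed.

Lemma cartan_cdot i j : cartan D i j * (eps C i)%:Z = C i j.
Proof. by have := rd_cartan D i j; rewrite cdot_eps -/(cartan D i j); lia. Qed.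

Lemma cartan_diag i : cartan D i i = 2.
Proof. by have := cartan_cdot i i; have := eps_gt0 i; rewrite cdot_eps; nia. Qed.

Lemma cartan_sym i j : cartan D j i * (eps C j)%:Z = cartan D i j * (eps C i)%:Z.
Proof. by rewrite !cartan_cdot cdotC. Qed.

Lemma cartan_offdiag i j : i != j -> exists m : nat, cartan D i j = - m%:Z.
Proof.
move=> /(cdot_offdiag C)[m]; rewrite -cartan_cdot cdot_eps => cE.
by exists m; have := eps_gt0 i; nia.
Qed.

Lemma rd_pairMn (h : rd_Y D) x n : rd_pair (h *+ n) x = rd_pair h x * n%:Z.
Proof.
elim: n => [|n IHn]; last by rewrite mulrS rd_pairDl IHn intS mulrDr mulr1.
by apply: (addIr (rd_pair (0 : rd_Y D) x)); rewrite -rd_pairDl addr0 mulr0 add0r.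
Qed.

Lemma rd_pairN (h : rd_Y D) x : rd_pair (- h) x = - rd_pair h x.
Proof. by apply: (addIr (rd_pair h x)); rewrite -rd_pairDl !addNr -(mulr0n h) rd_pairMn mulr0. Qed.

Lemma cartan_tau (tau : diagramInvolution D) i j : tau i = i -> cartan D i (tau j) = cartan D i j.
Proof.
move=> ti; have := cartan_cdot i (tau j).
by rewrite -[in C i _]ti tau_dot -cartan_cdot; have := eps_gt0 i; nia.
Qed.

End RootDatum.

(** * Consequences of the defining relations *)

Section Presentation.
Variables (I : finType) (C : cartanDatum I) (D : rootDatum C) (F : fieldType) (q : F).

Lemma serre_lrmorph (A B : algType F) (f : {lrmorphism A -> B}) w m x y :
  f (serre w m x y) = serre w m (f x) (f y).
Proof.
rewrite raddf_sum; apply: eq_bigr => n _.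
by rewrite /= linearZ /= !rmorphM !rmorphXn.
Qed.

(** Used with the quotient map from the free algebra: each relation between the generators of [Uq]
    is the image of an element of the defining ideal. *)
Lemma Urel_lift (A B : algType F) (f : {lrmorphism A -> B}) (E G : I -> A)
    (K : rd_Y D -> A) y :
    Urel q (f \o E) (f \o G) (f \o K) y -> exists2 x, Urel q E G K x & f x = y.
Proof.
case=> [|h h'|h i|h i|i j|i j ij|i j ij].
- by exists (K 0 - 1); [constructor | rewrite rmorphB rmorph1].
- by exists (K h * K h' - K (h + h')); [constructor | rewrite rmorphB rmorphM].
- by eexists; [exact: Urel_KE h i | rewrite rmorphB /= linearZ /= !rmorphM].
- by eexists; [exact: Urel_KF h i | rewrite rmorphB /= linearZ /= !rmorphM].
- by eexists; [exact: Urel_EF i j | rewrite !rmorphB /= linearZ /= rmorphB !rmorphM !rmorphXn].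
- by eexists; [exact: (Urel_serreE q E G K ij) | rewrite serre_lrmorph].
- by eexists; [exact: (Urel_serreF q E G K ij) | rewrite serre_lrmorph].
Qed.

Lemma Uq_Urel y : Urel q (UE q D) (UF q D) (@UK F q I C D) y -> y = 0.
Proof.
move=> /(Urel_lift (f := quot_pi (@Uideal F q I C D : ideal2 (Ufree F D))))[x xR <-].
rewrite -(quot_pi0 (@Uideal F q I C D : ideal2 (Ufree F D))); apply/quot_piP.
by rewrite subr0; apply: ideal_gen_sub.
Qed.

Variables (A : algType F) (E G : I -> A) (K : rd_Y D -> A).
Hypothesis rel : forall x, Urel q E G K x -> x = 0.

Local Notation v := (qi q C).
Local Notation Kt i := (Ktilde K i).
Local Notation KtV i := (KtildeV K i).

Let rel_eq x y : Urel q E G K (x - y) -> x = y.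
Proof. by move=> /rel/eqP; rewrite subr_eq0 => /eqP. Qed.

Lemma UK0 : K 0 = 1.
Proof. by apply: rel_eq; constructor. Qed.

Lemma UK_add h h' : K h * K h' = K (h + h').
Proof. by apply: rel_eq; constructor. Qed.

Lemma UK_E h i : K h * E i = q ^ rd_pair h (rd_alpha D i) *: (E i * K h).
Proof. by apply: rel_eq; constructor. Qed.

Lemma UK_F h i : K h * G i = q ^ (- rd_pair h (rd_alpha D i)) *: (G i * K h).
Proof. by apply: rel_eq; constructor. Qed.

Lemma UE_F i j : E i * G j - G j * E i
  = ((i == j)%:R / (v i - (v i)^-1)) *: (Kt i - KtV i).
Proof. by apply: rel_eq; constructor. Qed.

Lemma UE_serre i j : i != j -> serre (v i) (serre_deg D i j) (E i) (E j) = 0.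
Proof. by move=> ij; apply: rel; constructor. Qed.

Lemma UF_serre i j : i != j -> serre (v i) (serre_deg D i j) (G i) (G j) = 0.
Proof. by move=> ij; apply: rel; constructor. Qed.

Lemma UK_exp h n : K h ^+ n = K (h *+ n).
Proof.
elim: n => [|n IHn]; first by rewrite mulr0n UK0.
by rewrite exprS IHn UK_add mulrS.
Qed.

Lemma qi_cartan i j : q ^ (cartan D i j * (eps C i)%:Z) = v i ^ cartan D i j.
Proof. by rewrite mulrC -exprz_exp. Qed.

Lemma Ktilde_E i j : Kt i * E j = v i ^ cartan D i j *: (E j * Kt i).
Proof. by rewrite -qi_cartan /Ktilde UK_exp UK_E rd_pairMn. Qed.

Lemma Ktilde_F i j : Kt i * G j = v i ^ (- cartan D i j) *: (G j * Kt i).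
Proof. by rewrite -invr_expz -qi_cartan invr_expz /Ktilde UK_exp UK_F rd_pairMn. Qed.

(** By symmetry of the form the scalar is written in the parameter of [j]: in [iserre_UE] the
    divided powers belong to that index. *)
Lemma KtildeV_E i j : KtV i * E j = v j ^ (- cartan D j i) *: (E j * KtV i).
Proof.
rewrite -invr_expz -qi_cartan invr_expz cartan_sym -mulNr.
by rewrite /KtildeV UK_exp UK_E rd_pairMn rd_pairN.
Qed.

Lemma KtildeV_F i j : KtV i * G j = v j ^ cartan D j i *: (G j * KtV i).
Proof.
rewrite -qi_cartan cartan_sym -[cartan D i j]opprK mulNr.
by rewrite /KtildeV UK_exp UK_F rd_pairMn rd_pairN.
Qed.

Lemma Ktilde_KtildeV i : Kt i * KtV i = 1.
Proof. by rewrite /Ktilde /KtildeV !UK_exp UK_add mulNrn addrN UK0. Qed.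

Lemma KtildeV_Ktilde i : KtV i * Kt i = 1.
Proof. by rewrite /Ktilde /KtildeV !UK_exp UK_add mulNrn addNr UK0. Qed.

Lemma Ktilde_KtildeVC i j : Kt i * KtV j = KtV j * Kt i.
Proof. by rewrite /Ktilde /KtildeV !UK_exp !UK_add addrC. Qed.

Section Relation.
Variables (i j : I) (m : nat).
Hypothesis gen : q_generic (v i).
Hypothesis ij : i != j.
Hypothesis aij : cartan D i j = - m%:Z.

Let b := G i + (v i)^-1 *: (E i * KtV i).

Let deg : serre_deg D i j = m.+1.
Proof. by rewrite /serre_deg aij; lia. Qed.

Let EFi : E i * G i - G i * E i = (v i - (v i)^-1)^-1 *: (Kt i - KtV i).
Proof. by rewrite UE_F eqxx mul1r. Qed.

Let EFij (k : I) : i != k -> E i * G k = G k * E i.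
Proof. by move=> ik; apply/eqP; rewrite -subr_eq0 UE_F (negPf ik) mul0r scale0r. Qed.

Lemma iserre_UF (p' p : 'Z_2) : (p' == 1) = (odd m (+) (p == 1)) ->
  iserre (v i) p' p b m.+1 (G j) = 0.
Proof.
move=> pp; apply: (@iserre_serre _ _ _ gen m (E i) (G i) (Kt i) (KtV i)) => //.
- exact: Ktilde_KtildeV.
- exact: KtildeV_Ktilde.
- by rewrite Ktilde_F cartan_diag.
- exact: EFij.
- by rewrite Ktilde_F aij opprK.
- by rewrite -deg UF_serre.
Qed.

(** Meant for [tau j] in place of [j] and [j] in place of [k], which have the same Cartan integer
    with [i] when [i] is fixed by [tau]. *)
Lemma iserre_UE (p' p : 'Z_2) k : (p' == 1) = (odd m (+) (p == 1)) ->
    cartan D i k = - m%:Z ->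
  iserre (v i) p' p b m.+1 (E j * KtV k) = 0.
Proof.
move=> pp aik; apply: (@iserre_twist _ _ _ m (E i) (G i) (Kt i) (KtV i) (E j) (KtV k)) => //.
- exact: Ktilde_KtildeV.
- exact: KtildeV_Ktilde.
- by rewrite Ktilde_E cartan_diag.
- by rewrite Ktilde_F cartan_diag.
- apply/esym/eqP; rewrite -subr_eq0 UE_F [j == i]eq_sym (negPf ij) mul0r scale0r //.
- by rewrite Ktilde_E aij.
- by rewrite KtildeV_E aik opprK.
- by rewrite KtildeV_F aik.
- exact: Ktilde_KtildeVC.
- by rewrite -deg UE_serre.
Qed.
End Relation.
End Presentation.

(** * Transport along algebra morphisms and assembly of the result *)

Lemma idivpow_lrmorph (F : fieldType) (A B : algType F) (f : {lrmorphism A -> B})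
    (v : F) (b : A) (p : 'Z_2) n :
  f (idivpow v b p n) = idivpow v (f b) p n.
Proof.
rewrite linearZ rmorphM rmorph_prod; congr (_ *: (_ * _)).
  by case: (odd n); rewrite ?rmorph1.
by apply: eq_bigr => k _; rewrite rmorphB rmorphXn /= linearZ /= rmorph1.
Qed.

Lemma iserre_lrmorph (F : fieldType) (A B : algType F) (f : {lrmorphism A -> B})
    (v : F) (p' p : 'Z_2) (b x : A) N :
  f (iserre v p' p b N x) = iserre v p' p (f b) N (f x).
Proof.
rewrite raddf_sum; apply: eq_bigr => n _ /=.
by rewrite !rmorphM rmorph_sign /= !idivpow_lrmorph.
Qed.

Section SubalgVal.
Variables (R : comNzRingType) (A : algType R) (S : A -> Prop).
Local Notation subval := (@subalg_val R A S).

Fact subalg_val_is_zmod_morphism : zmod_morphism subval.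
Proof. exact: (rmorphB (\val : subalgType S -> A)). Qed.

Fact subalg_val_is_monoid_morphism : monoid_morphism subval.
Proof. by split. Qed.

Fact subalg_val_is_scalable : scalable subval.
Proof. by []. Qed.

HB.instance Definition _ := GRing.isZmodMorphism.Build (subalgType S) A subval
  subalg_val_is_zmod_morphism.
HB.instance Definition _ := GRing.isMonoidMorphism.Build (subalgType S) A subval
  subalg_val_is_monoid_morphism.
HB.instance Definition _ := GRing.isScalable.Build R (subalgType S) A *:%R subval
  subalg_val_is_scalable.
End SubalgVal.

Lemma iserre_linear (F : fieldType) (A : algType F) (v : F) (p' p : 'Z_2) (b x y : A) k N :
  iserre v p' p b N (x + k *: y) = iserre v p' p b N x + k *: iserre v p' p b N y.
Proof.
rewrite /iserre antidiagZ -antidiagD; apply: eq_antidiag => a c _.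
by move: (_ * idivpow _ _ _ a) (idivpow v b p c) => g h; rewrite mulrDr mulrDl -scalerAr -scalerAl.
Qed.

Lemma Z2_parity (m : nat) (p : 'Z_2) :
  ((- m%:Z)%:~R + p == 1) = (odd m (+) (p == 1)).
Proof.
have -> : (- m%:Z)%:~R = (odd m)%:R :> 'Z_2.
  rewrite mulrNz -pmulrn -[in LHS](odd_double_half m) natrD -mul2n natrM.
  by rewrite (_ : 2%:R = 0 :> 'Z_2) ?mul0r ?addr0; [case: (odd m) |]; apply/val_inj.
by case: (odd m); case: p => [[|[|]]].
Qed.

Theorem proposition3p5 (K : fieldType) (hK : [pchar K] =i pred0)
    (I : finType) (C : cartanDatum I) (D : rootDatum C)
    (tau : diagramInvolution D) (vs : I -> {fraction {poly K}})
    (hvs : distinguished (qvar K) tau vs) :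
  (forall (w : int) (u l : nat), (u, l) != (0%N, 0%N) ->
     Tfun (qvar K) w u l = 0) ->
  forall (i j : I), i != j -> tau i = i -> forall p : 'Z_2,
    let B k : Ui (qvar K) tau vs := iB (qvar K) tau vs k in
    let dB (r : 'Z_2) (m : nat) := idivpow (qi (qvar K) C i) (B i) r m in
    \sum_(n < (serre_deg D i j).+1)
      (-1) ^+ n * dB ((cartan D i j)%:~R + p) n * B j
        * dB p (serre_deg D i j - n)%N = 0.
Proof.
move=> _ i j ij taui p B dB; set q := qvar K; set v := qi q C i.
have [m aij] := cartan_offdiag D ij.
have gen : q_generic v.
  by apply: q_generic_exp; rewrite ?qvar_neq0 ?eps_gt0 //; exact: qvar_exp_neq1.
set p' := _ + p; have pp : (p' == 1) = (odd m (+) (p == 1)) by rewrite /p' aij Z2_parity.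
have -> : serre_deg D i j = m.+1 by rewrite /serre_deg aij; lia.
have itj : i != tau j by apply: contraNneq ij => e; rewrite -[j](tauK tau) -e taui.
rewrite -/(antidiag (fun a c => (-1) ^+ a * dB p' a * B j * dB p c) m.+1).
rewrite -/(iserre v p' p (B i) m.+1 (B j)).
have rel := @Uq_Urel I C D _ q.
have [_ vsi _] := hvs.
(* The inclusion into the quantum group is injective, so the relation may be checked there. *)
apply: val_inj; rewrite [RHS]raddf0.
rewrite [LHS](iserre_lrmorph (@subalg_val _ _ (@Ui_gen _ q _ _ _ tau vs))).
change (iserre v p' p (UB q tau vs i) m.+1 (UB q tau vs j) = 0).
(* The sum is linear in [B_j], so its two summands are treated separately; [tau i = i] forces the
   parameter of [B_i] to be [v^-1]. *)
rewrite [UB q tau vs j]/UB iserre_linear /UB taui vsi //.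
rewrite (iserre_UF rel gen ij aij pp) (iserre_UE rel gen itj _ pp aij) ?scaler0 ?addr0 //.
by rewrite cartan_tau.
Qed.
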